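(* Let $n\geq 1$, let $H$ be any graph, and let $S=K[V(S_n\odot H)]$, where $S_n$ is the $n$-star. Then (a) $\operatorname{depth}(S/I(S_n\odot H))=n+\operatorname{depth}(K[V(H)]/I(H))+|i(H)|$; (b) $\operatorname{sdepth}(S/I(S_n\odot H))\geq n+\operatorname{sdepth}(K[V(H)]/I(H))+|i(H)|$. In particular, if $H$ is a null graph, then $\operatorname{sdepth}(S/I(S_n\odot H))=n+|V(H)|$.
   Context: $K$ is a field. All graphs are finite, simple, have nonempty vertex set, and may have isolated vertices. Vertices of a graph $G$ are identified with the variables of the standard graded polynomial ring $K[V(G)]$. A null graph is a graph with no edges. $i(H)$ denotes the set of isolated vertices of $H$. Edge ideal convention: $I(G)\subset K[V(G)]$ is the ideal generated by all products $x_ix_j$ with $\{x_i,x_j\}\in E(G)$ together with all variables $x_k$ with $x_k$ an isolated vertex of $G$. Thus $K[V(H)]/I(H)\cong K[V(H')]/I(H')$, where $H'$ is the induced subgraph of $H$ on the non-isolated vertices, and if $H$ is null then $K[V(H)]/I(H)\cong K$ with depth and Stanley depth $0$. The corona product $X\odot H$ is the graph obtained from one copy of $X$ and $|V(X)|$ disjoint copies of $H$, namely $H_1,\dots,H_{|V(X)|}$, by joining the $i$-th vertex of $X$ to every vertex of $H_i$. It has no isolated vertices, so $I(X\odot H)$ is the usual edge ideal. For $k\geq 1$, the $k$-star $S_k$ is the tree on $k+1$ vertices consisting of one vertex joined to each of $k$ other vertices (and no other edges). $\operatorname{depth}$ is taken with respect to the graded maximal ideal. For a finitely generated $\mathbb{Z}^r$-graded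 module $A$ over a polynomial ring $R$ in $r$ variables over $K$, a Stanley decomposition is a finite direct sum of $K$-vector spaces $A=\bigoplus_{i} a_iK[X_i]$ with $a_i\in A$ homogeneous, $X_i$ a subset of the variables, and $a_iK[X_i]$ (the $K$-span of all $a_it$, $t$ a monomial in $K[X_i]$) a free $K[X_i]$-module; its Stanley depth is $\min_i|X_i|$, and $\operatorname{sdepth}(A)$ is the maximum over all Stanley decompositions of $A$. *)

(* Defs.v *)
From HB Require Import structures.
From mathcomp Require Import all_boot all_order all_algebra.
From mathcomp Require Import ring_quotient boolp.
From mathcomp.multinomials Require Import mpoly.

Set Implicit Arguments.
Unset Strict Implicit.
Unset Printing Implicit Defensive.

Import GRing.Theory.
Local Open Scope ring_scope.
Local Open Scope quotient_scope.

Record sgraph := SGraph {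
  vertex :> finType;
  edge : rel vertex;
  edge_sym : ssrbool.symmetric edge;
  edge_irr : irreflexive edge;
  vertex_gt0 : (0 < #|vertex|)%N
}.

Definition isolated (G : sgraph) : {set G} :=
  [set x | [forall y, ~~ edge x y]].

Definition null_graph (G : sgraph) : Prop := forall x y : G, ~~ edge x y.

(** The centre of the [n]-star is [ord0]. *)
Section Star.
Variable n : nat.

Definition star_edge : rel 'I_n.+1 :=
  fun x y => (x != y) && ((x == ord0) || (y == ord0)).

Lemma star_sym : ssrbool.symmetric star_edge.
Proof. by move=> x y; rewrite /star_edge eq_sym orbC. Qed.

Lemma star_irr : irreflexive star_edge.
Proof. by move=> x; rewrite /star_edge eqxx. Qed.

Lemma star_gt0 : (0 < #|'I_n.+1|)%N.
Proof. by rewrite card_ord. Qed.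

Definition star : sgraph := SGraph star_sym star_irr star_gt0.
End Star.

(** [inl x] is the vertex [x] of [X]; [inr (x, h)] is the vertex [h] of the
    copy of [H] attached to [x]. *)
Section Corona.
Variables X H : sgraph.

Definition corona_edge : rel (X + X * H)%type := fun u v =>
  match u, v with
  | inl x, inl y => edge x y
  | inl x, inr p => x == p.1
  | inr p, inl y => p.1 == y
  | inr p, inr q => (p.1 == q.1) && edge p.2 q.2
  end.

Lemma corona_sym : ssrbool.symmetric corona_edge.
Proof.
by move=> [x|p] [y|q] //=; rewrite 1?eq_sym // edge_sym.
Qed.

Lemma corona_irr : irreflexive corona_edge.
Proof. by move=> [x|p] /=; rewrite edge_irr // andbF. Qed.

Lemma corona_gt0 : (0 < #|{: X + X * H}|)%N.
Proof. by rewrite card_sum addn_gt0 vertex_gt0. Qed.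

Definition corona : sgraph := SGraph corona_sym corona_irr corona_gt0.
End Corona.

(** The maximum of a set of natural numbers, or [0] if there is none. *)
Definition is_max (P : nat -> Prop) (d : nat) : Prop :=
  P d /\ forall e, P e -> (e <= d)%N.

Definition maxP (P : nat -> Prop) : nat :=
  if pselect (exists d, is_max P d) is left h then projT1 (cid h) else 0%N.

Section Modules.
Variables (K : fieldType) (r : nat).
Local Notation R := {mpoly K[r]}.
Variable M : lmodType R.

(** Membership in the submodule [(s_0, ..., s_(k-1)) M]. *)
Definition in_smul (s : seq R) (x : M) : Prop :=
  exists c : 'I_(size s) -> M, x = \sum_(i < size s) s`_i *: c i.

(** The first clause says that [s] lies in the graded maximal ideal. *)
Definition regular_seq (s : seq R) : Prop :=
  [/\ forall i, (i < size s)%N -> (s`_i)@_0%MM = 0,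
      forall i, (i < size s)%N -> forall x : M,
        in_smul (take i s) (s`_i *: x) -> in_smul (take i s) x
    & exists x : M, ~ in_smul s x].

Definition depth : nat :=
  maxP (fun d => exists2 s, regular_seq s & size s = d).

(** [f] lies in the subring [K[X]]. *)
Definition mpoly_in (X : {set 'I_r}) (f : R) : Prop :=
  forall u, u \in msupp f -> forall i, i \notin X -> u i = 0%N.

Definition stanley_space (a : M) (X : {set 'I_r}) (x : M) : Prop :=
  exists2 f, mpoly_in X f & x = f *: a.

(** [comp d] is the homogeneous component of [M] of degree [d] in [Z^r]. *)
Variable comp : ('I_r -> int) -> M -> Prop.

(** The last clause says that [M] is the direct sum, over [i < k], of the
    spaces [a_i K[X_i]]. *)
Definition stanley_decomposition (k : nat)
    (a : 'I_k -> M) (X : 'I_k -> {set 'I_r}) : Prop :=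
  [/\ forall i, exists d, comp d (a i),
      forall i f, mpoly_in (X i) f -> f *: a i = 0 -> f = 0
    & forall x : M, exists! b : {ffun 'I_k -> M},
        (forall i, stanley_space (a i) (X i) (b i)) /\ x = \sum_i b i].

(** [#|X i| <= r], so the default value [r] of the minimum only matters for
    the empty decomposition of the zero module. *)
Definition sdepth : nat :=
  maxP (fun d => exists k (a : 'I_k -> M) (X : 'I_k -> {set 'I_r}),
    stanley_decomposition a X /\ d = \big[minn/r]_(i < k) #|X i|).

End Modules.

Section QuotientModule.
Variables (R : comNzRingType) (I : idealr R).
Local Notation Q := {ideal_quot I}.

Definition quot_scale (f : R) (x : Q) : Q := \pi_Q f * x.

Lemma quot_scaleA f g x : quot_scale f (quot_scale g x) = quot_scale (f * g) x.
Proof. by rewrite /quot_scale mulrA rmorphM. Qed.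

Lemma quot_scale1 : left_id 1 quot_scale.
Proof. by move=> x; rewrite /quot_scale rmorph1 mul1r. Qed.

Lemma quot_scaleDr : right_distributive quot_scale +%R.
Proof. by move=> f x y; rewrite /quot_scale mulrDr. Qed.

Lemma quot_scaleDl x : {morph quot_scale^~ x : f g / f + g}.
Proof. by move=> f g; rewrite /quot_scale rmorphD mulrDl. Qed.

HB.instance Definition _ := GRing.Zmodule_isLmodule.Build R Q
  quot_scaleA quot_scale1 quot_scaleDr quot_scaleDl.
End QuotientModule.

(** The [Z^r]-grading on [K[x_1, ..., x_r] / I], for a monomial ideal [I],
    is the image of the fine grading on the polynomial ring. *)
Definition quot_comp (K : fieldType) (r : nat) (I : idealr {mpoly K[r]})
    (d : 'I_r -> int) (x : {ideal_quot I}) : Prop :=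
  exists2 f : {mpoly K[r]},
    forall u, u \in msupp f -> forall i, (u i)%:Z = d i &
    x = \pi_{ideal_quot I} f.

(** The vertex [x] is identified with the variable of index [enum_rank x]. *)
Section EdgeIdeal.
Variables (K : fieldType) (G : sgraph).
Local Notation R := {mpoly K[#|G|]}.

Definition xvar (x : G) : R := 'X_(enum_rank x).

(** By convention the variables of the isolated vertices belong to the edge
    ideal.  Each edge is listed in both orders, which does not change the
    ideal. *)
Definition edge_gens : seq R :=
  [seq xvar p.1 * xvar p.2 | p : G * G in [pred p | edge p.1 p.2]]
  ++ [seq xvar x | x in isolated G].

Definition edge_ideal : {pred R} := fun f =>
  `[< exists c : 'I_(size edge_gens) -> R,
        f = \sum_(i < size edge_gens) c i * edge_gens`_i >].

Lemma edge_gens_coef0 g : g \in edge_gens -> g@_0%MM = 0.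
Proof.
have x0 x : (xvar x)@_0%MM = 0.
  by rewrite mcoeffX; case: eqP => // /eqP; rewrite mnm1_eq0.
rewrite mem_cat => /orP[/imageP[p _ ->]|/imageP[x _ ->]]; last exact: x0.
by rewrite (rmorphM (mcoeff 0%MM)) /= x0 mul0r.
Qed.

Lemma edge_ideal_closed : idealr_closed edge_ideal.
Proof.
split.
- by apply/asboolP; exists (fun=> 0); rewrite big1 // => i _; rewrite mul0r.
- apply/negP => /asboolP[c /(congr1 (mcoeff 0%MM))].
  rewrite mcoeff1 eqxx raddf_sum /= big1 => [/eqP|i _].
    by rewrite oner_eq0.
  by rewrite (rmorphM (mcoeff 0%MM)) /= (edge_gens_coef0 (mem_nth _ _)) ?mulr0.
- move=> a f g /asboolP[c ->] /asboolP[d ->]; apply/asboolP.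
  exists (fun i => a * c i + d i).
  by rewrite mulr_sumr -big_split; apply: eq_bigr => i _; rewrite mulrDl mulrA.
Qed.

HB.instance Definition _ := isIdealr.Build R edge_ideal edge_ideal_closed.

Definition edge_ring : lmodType R := {ideal_quot edge_ideal}.

Definition edge_depth : nat := depth edge_ring.
Definition edge_sdepth : nat := sdepth (@quot_comp K #|G| edge_ideal).
End EdgeIdeal.

(* Main.v *)
Require Import Defs.
From mathcomp Require Import all_boot all_order all_algebra.
From mathcomp Require Import ring_quotient boolp ring zify.
From mathcomp.multinomials Require Import mpoly.

(** A face of a graph is an independent set without isolated vertices.  The
    monomials supported on faces are a basis of the edge ring, and both
    invariants are computed from the poset of faces.

    Depth.  Koszul cohomology with respect to the variables detects regular
    sequences: a regular element shifts the range of vanishing by one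
    ([koszul_vanish_regular], [koszul_vanish_adjoin]), and vanishing in degree
    zero says that no nonzero element is killed by the maximal ideal, so that
    prime avoidance yields a regular element ([prime_avoidance]).  The Koszul
    complex is graded by the exponents of monomials, and its strands are
    complexes of cochains on families of faces.  This gives Hochster's formula
    ([depth_hochster]): the depth is at least [d] exactly if, for every set
    [Z] of vertices, the family of the sets [A] containing [Z] such that
    [A :\: Z] is a face has no cohomology in degrees less than [d].

    Faces of the corona.  The vertices of the star that lie in a face form an
    independent set [T], so the copy of [H] at the centre (if [T] consists of
    leaves) or at some leaf (if [T] is the centre) is met by the face in an
    arbitrary independent set of [H].  Keep this copy, and in each other copy
    treat the empty set and one fixed singleton as a single case.  The faces
    then fall into pieces, each of which is the join of an interval [lo, hi]
    with the faces of [H] in the kept copy ([pieceP]).  Each of the [n] other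
    copies contributes an element to [hi], namely its vertex on the star, or a
    vertex in the given intersection, or the vertex of the fixed singleton;
    the isolated vertices of the kept copy are free, so that [hi] has at least
    [n + #|isolated H|] elements ([card_piece_hi]).

    Conclusion.  The pieces form a filtration, and joining with an interval
    raises the depth by the cardinal of [hi] ([hochster_box]); this bounds the
    depth of the corona from below.  Joining a Stanley decomposition for [H]
    to every piece gives one for the corona, which proves (b).  For the upper
    bounds, let [leaf_face] consist of the leaves and of the isolated vertices
    of the copy at the centre.  Its link is the complex of faces of [H], and
    taking links at one vertex lowers the depth by at most one
    ([hochster_link], [box_hochster]).  If [H] is null, then [leaf_face] is a
    maximal face, and the cardinal of a maximal face bounds the Stanley depth
    ([edge_sdepth_le_facet]). *)

Set Implicit Arguments.
Unset Strict Implicit.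
Unset Printing Implicit Defensive.

Import Order.TTheory GRing.Theory.
Local Open Scope ring_scope.
Local Open Scope quotient_scope.

(** * Koszul cochains *)

Section Koszul.
Variables (R : comPzRingType) (V : finType) (rk : V -> nat).
Hypothesis rk_inj : injective rk.
Implicit Types (A C : {set V}) (f g : {set V} -> R).

Definition ksign (i : V) A : R := (-1) ^+ #|[set j in A | (rk j < rk i)%N]|.

(** The Koszul differential.  A function on subsets gathers cochains of all
    degrees; the value at a set of cardinal [i] belongs to the degree [i], and
    [rk] is the order of the variables that determines the signs. *)
Definition cobd (y : V -> R) f A : R :=
  \sum_(i in A) ksign i A * (y i * f (A :\ i)).

(** Contraction with the basis element of [v]. *)
Definition contract (v : V) f A : R :=
  if v \in A then 0 else ksign v (v |: A) * f (v |: A).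

Lemma ksignK i A : ksign i A * ksign i A = 1.
Proof. by rewrite -expr2 sqrr_sign. Qed.

Lemma ksignD1 i k C : i \in C ->
  ksign k (C :\ i) = if (rk i < rk k)%N then - ksign k C else ksign k C.
Proof.
move=> iC; rewrite /ksign; case: ifP => ik.
  rewrite [in RHS](cardsD1 i) inE iC ik exprS mulN1r opprK.
  by congr (_ ^+ #|pred_of_set _|); apply/setP => j; rewrite !inE andbA.
congr (_ ^+ #|pred_of_set _|); apply/setP => j; rewrite !inE.
by case: eqP => //= ->; rewrite ik andbF.
Qed.

Lemma ksign_anticomm i k C : i \in C -> k \in C -> i != k ->
  ksign i C * ksign k (C :\ i) = - (ksign k C * ksign i (C :\ k)).
Proof.
move=> iC kC neik; rewrite !ksignD1 //.
case: ltngtP => [_|_|/rk_inj ik]; last by rewrite ik eqxx in neik.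
- by rewrite mulrN mulrC.
- by rewrite mulrN opprK mulrC.
Qed.

(** Swapping the order in which two elements are removed changes the sign. *)
Lemma cobdK y f A : cobd y (cobd y f) A = 0.
Proof.
pose t i k := ksign i A * (y i * (ksign k (A :\ i) * (y k * f (A :\ i :\ k)))).
pose P (p : V * V) := [&& p.1 \in A, p.2 \in A & p.1 != p.2].
have -> : cobd y (cobd y f) A = \sum_(p | P p) t p.1 p.2.
  rewrite /cobd (eq_bigr (fun i => \sum_(k in A :\ i) t i k)) => [|i _]; last first.
    by rewrite !mulr_sumr; apply: eq_bigr.
  rewrite pair_big_dep; apply: eq_bigl => -[i k] /=.
  by rewrite /P /= in_setD1 [k == i]eq_sym [(_ != _) && _]andbC.
rewrite (bigID (fun p : V * V => (rk p.1 < rk p.2)%N)) /=.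
rewrite [X in _ + X](reindex_inj (h := fun p : V * V => (p.2, p.1))); last first.
  by move=> [a b] [c d] [-> ->].
rewrite [X in _ + X](eq_big (fun p : V * V => P p && (rk p.1 < rk p.2)%N)
   (fun p => - t p.1 p.2)).
- by rewrite sumrN subrr.
- move=> [i k]; rewrite /P /= eq_sym -leqNgt.
  case: (k \in A) (i \in A) => [] [] //=; case: eqP => //= neik.
  by rewrite leq_eqVlt; case: eqP => // /rk_inj ik; case: neik.
- move=> [i k]; rewrite /P /= => /andP[/and3P[kA iA neki] _].
  rewrite /t.
  have := ksign_anticomm kA iA neki; set a := _ * ksign _ (_ :\ k) => e.
  have -> : A :\ k :\ i = A :\ i :\ k by apply/setP => j; rewrite !inE andbCA.
  transitivity (a * (y k * (y i * f (A :\ i :\ k)))); first by rewrite /a; ring.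
  by rewrite e; ring.
Qed.

(** Hence [y v] annihilates the cohomology. *)
Lemma contract_homotopy v y f A :
  cobd y (contract v f) A + contract v (cobd y f) A = y v * f A.
Proof.
rewrite /contract; case: ifPn => vA.
  rewrite addr0 /cobd (big_setD1 v) //= [X in _ + X]big1.
    by rewrite addr0 !inE eqxx /= setD1K // mulrCA !mulrA -(mulrA (y v)) ksignK mulr1.
  by move=> i; rewrite !inE => /andP[neiv _]; rewrite eq_sym neiv vA /= !mulr0.
rewrite /cobd [in X in _ + X]big_setU1 //= setU1K // mulrDr.
rewrite [ksign v _ * (ksign v _ * _)]mulrA ksignK mul1r addrCA.
rewrite mulr_sumr -big_split big1 ?addr0 //= => i iA.
have neiv : i != v by apply: contraNneq vA => <-.
rewrite !inE eq_sym (negPf neiv) /= (negPf vA).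
have -> : v |: A :\ i = (v |: A) :\ i.
  by apply/setP => j; rewrite !inE; case: eqP => [->|//]; rewrite eq_sym neiv.
have Av : A = (v |: A) :\ v by rewrite setU1K.
set c := f _.
transitivity (y i * c * (ksign i A * ksign v ((v |: A) :\ i)
  + ksign v (v |: A) * ksign i (v |: A))); first by ring.
suff -> : ksign i A * ksign v ((v |: A) :\ i)
  + ksign v (v |: A) * ksign i (v |: A) = 0 by rewrite mulr0.
rewrite [X in ksign i X * _]Av !ksignD1 ?inE ?eqxx ?iA ?orbT //.
case: ltngtP => [_|_|/rk_inj iv]; last by rewrite iv eqxx in neiv.
- by ring.
- by ring.
Qed.

Lemma cobdB y f g A : cobd y (fun C => f C - g C) A = cobd y f A - cobd y g A.
Proof. by rewrite /cobd -sumrB; apply: eq_bigr => i _; ring. Qed.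

Lemma cobdD y f g A : cobd y (fun C => f C + g C) A = cobd y f A + cobd y g A.
Proof. by rewrite /cobd -big_split; apply: eq_bigr => i _; rewrite /=; ring. Qed.

Lemma cobdZ y c f A : cobd y (fun C => c * f C) A = c * cobd y f A.
Proof. by rewrite /cobd mulr_sumr; apply: eq_bigr => i _; ring. Qed.

Lemma eq_cobd y f g A :
  (forall i, i \in A -> f (A :\ i) = g (A :\ i)) -> cobd y f A = cobd y g A.
Proof. by move=> efg; apply: eq_bigr => i iA; rewrite efg. Qed.

Lemma contract_lin_homotopy (c y : V -> R) f A :
  cobd y (fun C => \sum_v c v * contract v f C) A
    + \sum_v c v * contract v (cobd y f) A = (\sum_v c v * y v) * f A.
Proof.
have -> : cobd y (fun C => \sum_v c v * contract v f C) A =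
          \sum_v c v * cobd y (contract v f) A.
  rewrite /cobd; under eq_bigr => i _ do rewrite 2!mulr_sumr.
  rewrite exchange_big; apply: eq_bigr => v _ /=.
  by rewrite mulr_sumr; apply: eq_bigr => i _; ring.
rewrite -big_split mulr_suml; apply: eq_bigr => v _ /=.
by rewrite -mulrDr contract_homotopy mulrA.
Qed.

Record is_ideal (B : R -> Prop) : Prop := IsIdeal {
  ideal0 : B 0;
  idealD : forall x x', B x -> B x' -> B (x + x');
  idealMl : forall c x, B x -> B (c * x) }.

Section Ideal.
Variables (B : R -> Prop) (idB : is_ideal B).

Lemma idealN x : B x -> B (- x).
Proof. by move=> Bx; rewrite -mulN1r; apply: idealMl. Qed.

Lemma idealB x x' : B x -> B x' -> B (x - x').
Proof. by move=> Bx Bx'; apply: idealD => //; apply: idealN. Qed.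

Lemma ideal_sum (I : Type) (r : seq I) (P : pred I) (F : I -> R) :
  (forall i, P i -> B (F i)) -> B (\sum_(i <- r | P i) F i).
Proof. by move=> BF; elim/big_ind: _ => //; [apply: ideal0|apply: idealD]. Qed.

Lemma cobd_ideal y f A :
  (forall i, i \in A -> B (f (A :\ i))) -> B (cobd y f A).
Proof. by move=> Bf; apply: ideal_sum => i iA; do 2!apply: idealMl => //; exact: Bf. Qed.

Definition ideal_adjoin (s : R) x := exists c, B (x - c * s).

End Ideal.

(** The cohomology is that of [R / B].  A cochain of degree [i] is represented by
    a function on all sets, of which only the values at the sets of cardinal [i]
    matter. *)
Definition koszul_vanish (y : V -> R) (B : R -> Prop) d :=
  forall f i, (i < d)%N ->
    (forall A, #|A| = i.+1 -> B (cobd y f A)) ->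
    exists g, forall A, #|A| = i -> B (f A - cobd y g A).

Lemma eq_koszul_vanish y B B' d : (forall x, B x <-> B' x) ->
  koszul_vanish y B d -> koszul_vanish y B' d.
Proof.
move=> eqB vB f i id fc.
by have [|g fg] := vB f i id => [A /fc /eqB //|]; exists g => A /fg /eqB.
Qed.

Definition regular_mod (B : R -> Prop) s := forall x, B (s * x) -> B x.

Lemma card_setD1S A i n : #|A| = n.+1 -> i \in A -> #|A :\ i| = n.
Proof. by move=> cA iA; move: (cardsD1 i A); rewrite iA cA => -[->]. Qed.

(** Multiplication by [s] is zero on cohomology: if [s f = d w] modulo [B],
    then [w] is a cocycle modulo [B + (s)], and a potential of [w] is divided
    by [s]. *)
Lemma koszul_vanish_regular y B s d : is_ideal B ->
    (exists c, s = \sum_v c v * y v) -> regular_mod B s ->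
  koszul_vanish y (ideal_adjoin B s) d -> koszul_vanish y B d.+1.
Proof.
move=> idB [c sE] regs vBs f i id fc.
pose w C := \sum_v c v * contract v f C.
have sfw A : #|A| = i -> B (s * f A - cobd y w A).
  move=> cA; rewrite sE -(contract_lin_homotopy c y f A) addrC addKr.
  apply: ideal_sum => // v _; apply: idealMl => //; rewrite /contract.
  case: ifPn => vA; first exact: ideal0.
  by apply: idealMl => //; apply: fc; rewrite cardsU1 vA cA.
case: i id fc sfw => [|i] id fc sfw.
  exists (fun=> 0) => A cA; rewrite /cobd big1 => [|j _]; last by rewrite !mulr0.
  rewrite subr0; apply: regs; have := sfw A cA.
  by rewrite (cards0_eq cA) /cobd big_set0 subr0.
have [|v wv] := vBs w i id.
  move=> A cA; exists (f A); rewrite -opprB mulrC; apply: idealN => //; exact: sfw.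
have [w' ww'] : exists w', forall A, #|A| = i -> B (w A - cobd y v A - w' A * s).
  have /choice[w' ww'] : forall A, exists c, #|A| = i -> B (w A - cobd y v A - c * s).
    by move=> A; have [/wv[a Ba]|nA] := pselect (#|A| = i); [exists a|exists 0].
  by exists w'.
exists w' => A cA; apply: regs.
have -> : s * (f A - cobd y w' A) = (s * f A - cobd y w A)
   + cobd y (fun C => w C - cobd y v C - w' C * s) A.
  rewrite !cobdB cobdK (@eq_cobd _ (fun C => w' C * s) (fun C => s * w' C)).
    by rewrite cobdZ; ring.
  by move=> j _; rewrite mulrC.
apply: idealD => //; first exact: sfw.
by apply: cobd_ideal => // j jA; apply/ww'/card_setD1S.
Qed.

(** If [d f = s g] modulo [B], then [g] is a cocycle because [s] is regular; a
    potential [h] of [g] makes [f - s h] a cocycle modulo [B]. *)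
Lemma koszul_vanish_adjoin y B s d : is_ideal B -> regular_mod B s ->
  koszul_vanish y B d.+1 -> koszul_vanish y (ideal_adjoin B s) d.
Proof.
move=> idB regs vB f i id fc.
have [g fg] : exists g, forall A, #|A| = i.+1 -> B (cobd y f A - g A * s).
  have /choice[g fg] : forall A, exists c, #|A| = i.+1 -> B (cobd y f A - c * s).
    by move=> A; have [/fc[a Ba]|nA] := pselect (#|A| = i.+1); [exists a|exists 0].
  by exists g.
have [|h gh] := vB g i.+1 id.
  move=> A cA; apply: regs; rewrite -[s * _]opprK; apply: idealN => //.
  have -> : - (s * cobd y g A) = cobd y (fun C => cobd y f C - g C * s) A.
    rewrite cobdB cobdK sub0r (@eq_cobd _ (fun C => g C * s) (fun C => s * g C)) ?cobdZ //.
    by move=> j _; rewrite mulrC.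
  by apply: cobd_ideal => // j jA; apply/fg/card_setD1S.
have [|k fk] := vB (fun C => f C - s * h C) i (ltnW id).
  move=> A cA; rewrite cobdB cobdZ.
  have -> : cobd y f A - s * cobd y h A =
    (cobd y f A - g A * s) + s * (g A - cobd y h A) by ring.
  by apply: idealD => //; [exact: fg|apply: idealMl => //; exact: gh].
exists k => A cA; exists (h A).
by have := fk A cA; congr B; ring.
Qed.

(** The cocycles of degree zero are the elements killed by all [y v]. *)
Lemma koszul_vanish_socle y B d a :
  koszul_vanish y B d.+1 -> (forall v, B (y v * a)) -> is_ideal B -> B a.
Proof.
move=> vB ya idB; have [|g fg] := vB (fun=> a) 0 isT.
  move=> A _; apply: ideal_sum => // i _; exact: idealMl.
by have := fg set0 (cards0 _); rewrite /cobd big_set0 subr0.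
Qed.

End Koszul.

(** * Existence of regular elements *)

(** Choose again and again a position at which the minimum of the remaining
    terms is attained. *)
Lemma nondecreasing_subsequence (u : nat -> nat) :
  exists phi : nat -> nat, {homo phi : i j / (i < j)%N} /\
    {homo u \o phi : i j / (i <= j)%N}.
Proof.
have next k : exists m, (k <= m)%N /\ forall m', (k <= m')%N -> (u m <= u m')%N.
  suff: forall N m, (k <= m)%N -> (u m <= N)%N ->
      exists m, (k <= m)%N /\ forall m', (k <= m')%N -> (u m <= u m')%N.
    by move=> /(_ (u k) k (leqnn k) (leqnn _)).
  elim=> [|N IHN] m km umN.
    by exists m; split=> // m' _; apply: leq_trans umN _.
  have [[m' km' lt]|min] := pselect (exists2 m', (k <= m')%N & (u m' < u m)%N).
    by apply: (IHN m') => //; rewrite -ltnS; apply: leq_trans lt umN.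
  exists m; split=> // m' km'; rewrite leqNgt; apply/negP => lt.
  by apply: min; exists m'.
have [a aP] := choice next.
pose phi := fix phi i := if i is i'.+1 then a (phi i').+1 else a 0%N.
have phiP i : exists k, phi i = a k by case: i => [|i]; [exists 0%N|exists (phi i).+1].
have lephi i : (phi i < phi i.+1)%N by rewrite /=; have [] := aP (phi i).+1.
exists phi; split; first exact: homo_ltn ltn_trans lephi.
apply: homo_leq leqnn leq_trans _ => i; rewrite [_ i]/= [_ i.+1]/=.
have [k phik] := phiP i; rewrite phik; have [ka amin] := aP k; apply: amin.
by rewrite -phik; apply: leq_trans ka _; rewrite -phik; apply: ltnW (lephi i).
Qed.

(** Make one exponent after another nondecreasing along a subsequence. *)
Lemma dickson n (f : nat -> 'X_{1..n}) : exists i j, (i < j)%N /\ (f i <= f j)%MM.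
Proof.
suff [phi [phi_mono fphi]] : exists phi : nat -> nat, {homo phi : i j / (i < j)%N} /\
    forall c, c \in enum 'I_n -> {homo (fun i => f (phi i) c) : i j / (i <= j)%N}.
  exists (phi 0%N), (phi 1%N); split; first exact: phi_mono.
  by apply/mnm_lepP => c; apply: (fphi c _ 0%N 1%N); rewrite ?mem_enum.
elim: (enum 'I_n) => [|c s [phi [phi_mono fphi]]]; first by exists id; split.
have [psi [psi_mono fpsi]] := nondecreasing_subsequence (fun i => f (phi i) c).
exists (phi \o psi); split=> [i j ij|c']; first exact/phi_mono/psi_mono.
have psi_le : {homo psi : i j / (i <= j)%N}.
  by move=> i j; rewrite leq_eqVlt => /predU1P[->//|/psi_mono/ltnW].
rewrite inE => /predU1P[->|c's]; first exact: fpsi.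
by move=> i j ij; apply: (fphi c' c's); apply: psi_le.
Qed.

Section Noether.
Variables (K : fieldType) (n : nat).
Local Notation R := {mpoly K[n]}.
Implicit Types (B : R -> Prop) (f : nat -> R).

Definition ideal_seq B f k : R -> Prop :=
  fun x => exists c : nat -> R, B (x - \sum_(j < k) c j * f j).

Lemma is_ideal_seq B f k : is_ideal B -> is_ideal (ideal_seq B f k).
Proof.
move=> idB; split.
- exists (fun=> 0); rewrite big1 ?subr0 => [|j _]; last by rewrite mul0r.
  exact: ideal0.
- move=> x x' [c Bx] [c' Bx']; exists (fun j => c j + c' j).
  have -> : x + x' - \sum_(j < k) (c j + c' j) * f j =
    (x - \sum_(j < k) c j * f j) + (x' - \sum_(j < k) c' j * f j).
    rewrite addrACA -opprD -big_split; congr (_ - _).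
    by apply: eq_bigr => j _; rewrite mulrDl.
  exact: idealD.
- move=> a x [c Bx]; exists (fun j => a * c j).
  under eq_bigr => j _ do rewrite -mulrA.
  by rewrite -mulr_sumr -mulrBr; apply: idealMl.
Qed.

Lemma mem_ideal_seq B f k j : is_ideal B -> (j < k)%N -> ideal_seq B f k (f j).
Proof.
move=> idB jk; exists (fun i => (i == j)%:R).
rewrite (bigD1 (Ordinal jk)) //= eqxx mul1r big1 ?addr0 ?subrr; first exact: ideal0.
by move=> i; rewrite -val_eqE /= => /negPf ->; rewrite mul0r.
Qed.

Lemma sub_ideal_seq B f k x : B x -> ideal_seq B f k x.
Proof. by exists (fun=> 0); rewrite big1 ?subr0 // => j _; rewrite mul0r. Qed.

Lemma ideal_seq_trans B f k j x : is_ideal B -> (j <= k)%N ->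
  ideal_seq B f j x -> ideal_seq B f k x.
Proof.
move=> idB jk [c Bx]; have idk := is_ideal_seq f k idB.
rewrite -(subrK (\sum_(i < j) c i * f i) x); apply: idealD => //.
  exact: sub_ideal_seq.
apply: ideal_sum => // i _; apply: idealMl => //; apply: mem_ideal_seq => //.
exact: leq_trans jk.
Qed.

Lemma mlead_minimal (C : R -> Prop) p : C p ->
  exists2 p, C p & forall q, C q -> ~~ (mlead q < mlead p)%O.
Proof.
move: {2}(mlead p) (erefl (mlead p)) => m.
elim/(well_founded_ind (@ltom_wf n)): m p => m IHm p pm Cp.
have [[q [Cq qp]]|minp] := pselect (exists q, C q /\ (mlead q < mlead p)%O).
  by apply: (IHm (mlead q) _ q) => //; rewrite -pm.
by exists p => // q Cq; apply/negP => qp; apply: minp; exists q.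
Qed.

(** Subtracting a multiple of [p] cancels the leading term of [q]. *)
Lemma mlead_reduce (p q : R) : p != 0 -> q != 0 -> (mlead p <= mlead q)%MM ->
  exists c, q - c * p = 0 \/ (mlead (q - c * p) < mlead q)%O.
Proof.
move=> p0 q0 pq.
pose c := (mleadc q / mleadc p)%:MP * 'X_[(mlead q - mlead p)%MM].
have lp : mleadc p != 0 by rewrite mleadc_eq0.
have lcp : (mlead (c * p) <= mlead q)%O.
  apply: le_trans (mleadM_le _ _) _.
  rewrite /c mul_mpolyC mleadZ; last by rewrite mulf_neq0 ?invr_eq0 ?mleadc_eq0.
  by rewrite mleadXm submK.
have coef0 : (q - c * p)@_(mlead q) = 0.
  have e : ('X_[(mlead q - mlead p)%MM] * p)@_(mlead q) = mleadc p.
    by rewrite mulrC -{1}(submK pq) mcoeffMX.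
  by rewrite mcoeffB /c -mulrA mcoeffCM e divfK // subrr.
exists c; have [->|d0] := eqVneq (q - c * p) 0; [by left|right].
rewrite lt_neqAle; apply/andP; split.
  by apply: contraNneq d0 => e; rewrite -mleadc_eq0 e coef0.
apply: le_trans (mleadB_le _ _) _.
by rewrite leUx lcp lexx.
Qed.

(** If there were no such [k], replace each [f k] by an element of minimal
    leading monomial in its coset modulo the previous ones; by Dickson's lemma
    one of these leading monomials divides a later one, which contradicts
    minimality. *)
Lemma noetherian_seq B f : is_ideal B -> exists k, ideal_seq B f k (f k).
Proof.
move=> idB; apply/not_existsP => nf.
pose C k p := ideal_seq B f k (p - f k).
have /choice[p pP] : forall k, exists p, C k p /\
    forall q, C k q -> ~~ (mlead q < mlead p)%O.
  move=> k; have [|p Cp minp] := @mlead_minimal (C k) (f k); last by exists p.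
  by rewrite /C subrr; apply: ideal0; apply: is_ideal_seq.
have p0 k : p k != 0.
  apply/negP => /eqP pk0; have [] := pP k; rewrite pk0 /C sub0r => Ck _.
  by apply: (nf k); rewrite -[f k]opprK; apply: idealN Ck; apply: is_ideal_seq.
have [i [j [ij leij]]] := dickson (fun k => mlead (p k)).
have [c cP] := mlead_reduce (p0 i) (p0 j) leij.
have idj := is_ideal_seq f j idB.
have Cq : C j (p j - c * p i).
  rewrite /C addrAC; apply: idealB => //; first by case: (pP j).
  apply: idealMl => //; rewrite -(subrK (f i) (p i)); apply: idealD => //.
    by apply: ideal_seq_trans (proj1 (pP i)) => //; apply: ltnW.
  exact: mem_ideal_seq.
case: cP => [q0|]; last by apply/negP; have [_] := pP j; apply.
apply: (nf j); move: Cq; rewrite q0 /C sub0r => /(idealN idj).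
by rewrite opprK.
Qed.

(** The ideals [B : a] for these [a] are the maximal associated primes of
    [R / B]. *)
Definition max_colon B a :=
  ~ B a /\ forall a', ~ B a' ->
    (forall x, B (x * a) -> B (x * a')) -> forall x, B (x * a') -> B (x * a).

(** An infinite ascending chain of colon ideals would give elements [g_k] of
    the [(k+1)]-st that are not in the [k]-th, contrary to
    [noetherian_seq]. *)
Lemma max_colon_exists B a : is_ideal B -> ~ B a ->
  exists2 a', max_colon B a' & forall x, B (x * a) -> B (x * a').
Proof.
move=> idB Ba; apply: contrapT => nmax.
pose S := {b | ~ B b /\ forall x, B (x * a) -> B (x * b)}.
have step (b : S) : exists gb : R * S, [/\ ~ B (gb.1 * sval b),
    B (gb.1 * sval gb.2) & forall x, B (x * sval b) -> B (x * sval gb.2)].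
  case: b => b [Bb ab] /=; apply: contrapT => nstep; apply: nmax; exists b => //.
  split=> // b' Bb' bb' x xb'; apply: contrapT => xb; apply: nstep.
  have ab' y : B (y * a) -> B (y * b') by move=> /ab/bb'.
  by exists (x, exist _ b' (conj Bb' ab')).
have [next nextP] := choice step.
pose b0 : S := exist _ a (conj Ba (fun x => id)).
pose b i := iter i (fun c => (next c).2) b0.
pose g i := (next (b i)).1.
have mono x i j : (i <= j)%N -> B (x * sval (b i)) -> B (x * sval (b j)).
  move/subnKC <-; elim: (j - i)%N => [|k IHk]; rewrite ?addn0 // addnS => /IHk.
  by have [_ _] := nextP (b (i + k)%N); apply.
have [k [c Bc]] := noetherian_seq g idB.
have [nB _ _] := nextP (b k); apply: nB; rewrite -/(g k).
rewrite -(subrK (\sum_(j < k) c j * g j) (g k)) mulrDl; apply: idealD => //.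
  by rewrite mulrC; apply: idealMl.
rewrite mulr_suml; apply: ideal_sum => // j _; rewrite -mulrA; apply: idealMl => //.
apply: (mono _ j.+1) => //; rewrite /g /=.
by have [_] := nextP (b j).
Qed.

(** If [q * a] is not in [B], then [B : q a] contains [B : a], hence equals it by
    maximality, and [p] belongs to the former. *)
Lemma max_colon_prime B a p q : is_ideal B -> max_colon B a ->
  B (p * q * a) -> B (p * a) \/ B (q * a).
Proof.
move=> idB [Ba maxa] pqa; have [qa|nqa] := pselect (B (q * a)); first by right.
left; apply: (maxa (q * a)) => //; last by rewrite mulrA.
by move=> x xa; rewrite mulrCA; apply: idealMl.
Qed.

(** Prime avoidance, carried out one associated prime at a time.  If every
    element of [m] were a zero divisor modulo [B], there would be sequences
    [s_k] in [m] and [a_k] such that [s_k] avoids the maximal colon ideals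
    [B : a_j] for [j < k] but lies in [B : a_k].  An element of
    [B : a_0, ..., B : a_(k-1)] outside the prime [B : a_k] witnesses that
    [a_k] is not in [B + (a_0, ..., a_(k-1))]. *)
Lemma prime_avoidance B (m : R -> Prop) : is_ideal B -> is_ideal m ->
    (forall a, (forall x, m x -> B (x * a)) -> B a) ->
  exists2 s, m s & regular_mod B s.
Proof.
move=> idB idm socle; apply: contrapT => nreg.
(* [as_] lists the elements [a_j] already found. *)
pose inv (as_ : seq R) s :=
  m s /\ forall a, a \in as_ -> max_colon B a /\ ~ B (s * a).
have step as_ s : inv as_ s -> exists a, exists2 s', inv (rcons as_ a) s' &
    exists2 p, ~ B (p * a) & forall a', a' \in as_ -> B (p * a').
  move=> [ms asP].
  have [a0 Ba0 Bsa0] : exists2 a, ~ B a & B (s * a).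
    apply: contrapT => reg; apply: nreg; exists s => // x sx.
    by apply: contrapT => Bx; apply: reg; exists x.
  have [a maxa a0a] := max_colon_exists idB Ba0.
  have sa : B (s * a) by apply: a0a.
  have [p pa pas] : exists2 p, ~ B (p * a) & forall a', a' \in as_ -> B (p * a').
    elim: as_ asP => [|b as_ IH] asP; first by exists 1; rewrite ?mul1r //; case: maxa.
    have [|p pa pas] := IH; first by move=> a' a's; apply: asP; rewrite inE a's orbT.
    have [maxb sb] := asP b (mem_head _ _).
    have [q qb qa] : exists2 q, B (q * b) & ~ B (q * a).
      apply: contrapT => sub; apply: sb; have [_ bmax] := maxb.
      apply: (bmax a) => //; first by case: maxa.
      by move=> x xb; apply: contrapT => xa; apply: sub; exists x.
    exists (p * q); first by move=> /(max_colon_prime idB maxa)[].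
    move=> a'; rewrite inE => /predU1P[->|a's]; first by rewrite -mulrA; apply: idealMl.
    by rewrite mulrAC mulrC; apply: idealMl => //; apply: pas.
  have [g mg ga] : exists2 g, m g & ~ B (g * a).
    apply: contrapT => nog; case: maxa => Ba _; apply: Ba; apply: socle => x mx.
    by apply: contrapT => xa; apply: nog; exists x.
  exists a, (s + p * g); last by exists p.
  split; first by apply: idealD => //; apply: idealMl.
  move=> a'; rewrite mem_rcons inE => /predU1P[->|a's].
    split=> // Bspg.
    have pga : B (p * g * a).
      by rewrite -[p * g](addKr s) mulrDl mulNr addrC; apply: idealB.
    by have [/pa|/ga] := max_colon_prime idB maxa pga.
  have [maxa' sa'] := asP _ a's; split=> // Bspg; apply: sa'.
  rewrite -(addrK (p * g) s) mulrBl; apply: idealB => //.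
  by rewrite mulrAC mulrC; apply: idealMl => //; apply: pas.
pose S := {x : seq R * R | inv x.1 x.2}.
have stepS (x : S) : exists y : S, exists a, (sval y).1 = rcons (sval x).1 a /\
    exists2 p, ~ B (p * a) & forall a', a' \in (sval x).1 -> B (p * a').
  case: x => -[as_ s] /= xP; have [a [s' invs' ap]] := step _ _ xP.
  by exists (exist _ (rcons as_ a, s') invs'); exists a.
have [next nextP] := choice stepS.
have [elt eltP] := choice nextP.
have inv0 : inv [::] 0 by split=> //; apply: ideal0.
pose x0 : S := exist _ ([::], 0) inv0.
pose st i := iter i next x0; pose a i := elt (st i).
have stE k : (sval (st k)).1 = mkseq a k.
  elim: k => [|k IHk] //; have [e _] := eltP (st k).
  by rewrite [st _]/= e IHk mkseqS.
have [k [c Bc]] := noetherian_seq a idB.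
have [_ [p pa pas]] := eltP (st k); apply: pa; rewrite -/(a k).
rewrite -(subrK (\sum_(j < k) c j * a j) (a k)) mulrDr; apply: idealD => //.
  exact: idealMl.
rewrite mulr_sumr; apply: ideal_sum => // j _; rewrite mulrCA; apply: idealMl => //.
by apply: pas; rewrite stE; apply: map_f; rewrite mem_iota add0n ltn_ord.
Qed.
End Noether.

(** * Depth of cyclic modules *)

Section CyclicDepth.
Variables (K : fieldType) (r : nat).
Local Notation R := {mpoly K[r]}.
Variables (M : lmodType R) (e : M) (V : finType) (rk : V -> nat) (y : V -> R).
Hypothesis rk_inj : injective rk.
Hypothesis e_gen : forall x : M, exists f : R, x = f *: e.
Hypothesis ann_proper : forall f : R, f *: e = 0 -> f@_0%MM = 0.
Hypothesis y_gen : forall f : R, f@_0%MM = 0 <-> exists c, f = \sum_v c v * y v.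

(** The colon ideal of [e] into [s M]: the quotient of the polynomial ring by it
    is [M / s M]. *)
Definition colon_smul s (f : R) := in_smul s (f *: e).

Lemma in_smulP (s : seq R) (x : M) : in_smul s x <->
  exists c : nat -> M, x = \sum_(i < size s) s`_i *: c i.
Proof.
split=> -[c ->]; last by exists (fun i => c i).
exists (fun i => if insub i is Some j then c j else 0).
by apply: eq_bigr => i _; rewrite valK.
Qed.

Lemma in_smul_rcons (s : seq R) a (x : M) :
  in_smul (rcons s a) x <-> exists c, in_smul s (x - a *: c).
Proof.
have eqs c : \sum_(i < size s) (rcons s a)`_i *: c i = \sum_(i < size s) s`_i *: c i :> M.
  by apply: eq_bigr => i _; rewrite nth_rcons ltn_ord.
split=> [/in_smulP[c ->]|[c /in_smulP[c' xE]]].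
  exists (c (size s)); apply/in_smulP; exists c.
  by rewrite size_rcons big_ord_recr /= nth_rcons ltnn eqxx addrK eqs.
apply/in_smulP; exists (fun i => if (i < size s)%N then c' i else c).
rewrite size_rcons big_ord_recr /= eqs nth_rcons ltnn eqxx.
rewrite -(subrK (a *: c) x) xE; congr (_ + _).
by apply: eq_bigr => i _; rewrite ltn_ord.
Qed.

Lemma in_smul_nil x : in_smul [::] x <-> x = 0 :> M.
Proof.
by split=> [[c]|->]; [rewrite big_ord0|exists (fun=> 0); rewrite big_ord0].
Qed.

Lemma is_ideal_colon_smul s : is_ideal (colon_smul s).
Proof.
split.
- exists (fun=> 0); rewrite scale0r big1 // => i _; exact: scaler0.
- move=> f f' [c fE] [c' fE']; exists (fun i => c i + c' i).
  by rewrite scalerDl fE fE' -big_split; apply: eq_bigr => i _; rewrite scalerDr.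
- move=> a f [c fE]; exists (fun i => a *: c i); rewrite -scalerA fE scaler_sumr.
  by apply: eq_bigr => i _; rewrite !scalerA mulrC.
Qed.

Lemma colon_smul_rcons s a f :
  colon_smul (rcons s a) f <-> ideal_adjoin (colon_smul s) a f.
Proof.
split=> [/in_smul_rcons[c sc]|[c sc]].
  have [g cE] := e_gen c; exists g; move: sc.
  by rewrite cE scalerA -scalerBl [a * g]mulrC.
by apply/in_smul_rcons; exists (c *: e); rewrite scalerA -scalerBl [a * c]mulrC.
Qed.

Lemma regular_modP s a : regular_mod (colon_smul s) a <->
  forall x : M, in_smul s (a *: x) -> in_smul s x.
Proof.
split=> [reg x|reg f sf].
  by have [f ->] := e_gen x; rewrite scalerA; apply: reg.
by apply: reg; rewrite scalerA.
Qed.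

(** Modulo the whole sequence there is nothing to prove; removing its elements
    from the last to the first, each one extends the vanishing by a degree. *)
Lemma regular_seq_koszul s : regular_seq M s ->
  koszul_vanish rk y (colon_smul [::]) (size s).
Proof.
move=> [s0 sreg _].
suff: forall k, (k <= size s)%N ->
    koszul_vanish rk y (colon_smul (take (size s - k) s)) k.
  by move=> /(_ (size s)); rewrite subnn take0; apply.
elim=> [|k IHk] ks; first by move=> f i; rewrite ltn0.
have ils : (size s - k.+1 < size s)%N by rewrite ltn_subrL; case: (size s) ks.
apply: (koszul_vanish_regular rk_inj (s := s`_(size s - k.+1))).
- exact: is_ideal_colon_smul.
- exact/y_gen/s0.
- by apply/regular_modP; apply: sreg.
apply: eq_koszul_vanish (IHk (ltnW ks)) => f.
by rewrite -(subnSK ks) (take_nth 0) //; apply: colon_smul_rcons.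
Qed.

(** Nakayama's lemma for the cyclic module [M]. *)
Lemma maximal_not_smul s : (forall i, (i < size s)%N -> (s`_i)@_0%MM = 0) ->
  ~ in_smul s e.
Proof.
move=> s0 [c eE].
have [g gE] := choice (fun i => e_gen (c i)).
pose h := \sum_(i < size s) s`_i * g i.
have : (1 - h)@_0%MM = 0.
  apply: ann_proper; rewrite scalerBl scale1r {1}eE /h scaler_suml -sumrB big1 // => i _.
  by rewrite gE scalerA subrr.
rewrite mcoeffB mcoeff1 eqxx /h raddf_sum big1 /= => [|i _].
  by rewrite subr0 => /eqP; rewrite oner_eq0.
by rewrite (rmorphM (mcoeff 0%MM)) /= s0 ?mul0r.
Qed.

(** As long as the range of vanishing is not exhausted, the socle of [M / s M]
    is zero, and prime avoidance provides the next element. *)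
Lemma koszul_regular_seq d : koszul_vanish rk y (colon_smul [::]) d ->
  exists2 s, regular_seq M s & size s = d.
Proof.
move=> vd; suff: forall k, (k <= d)%N -> exists2 s, regular_seq M s /\
    koszul_vanish rk y (colon_smul s) (d - k) & size s = k.
  by move=> /(_ d (leqnn d))[s [regs _] sd]; exists s.
elim=> [|k IHk] kd.
  exists [::] => //; rewrite subn0; split=> //.
  by split=> //; exists e; apply: maximal_not_smul.
have [s [[s0 sreg _] vs] sk] := IHk (ltnW kd).
have ids := is_ideal_colon_smul s.
have idm : is_ideal (fun f : R => f@_0%MM = 0).
  split=> [|f f' f0 f'0|c f f0]; first exact: mcoeff0.
    by rewrite mcoeffD f0 f'0 addr0.
  by rewrite (rmorphM (mcoeff 0%MM)) /= f0 mulr0.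
move: vs; rewrite -(subnSK kd) => vs.
have [|a a0 areg] := prime_avoidance ids idm.
  move=> a ma; apply: (koszul_vanish_socle vs) => // v; apply: ma; apply/y_gen.
  exists (fun i => (i == v)%:R); rewrite (bigD1 v) //= eqxx mul1r big1 ?addr0 //.
  by move=> i /negPf ->; rewrite mul0r.
have sa0 i : (i < size (rcons s a))%N -> ((rcons s a)`_i)@_0%MM = 0.
  rewrite size_rcons nth_rcons ltnS leq_eqVlt => /predU1P[->|iks].
    by rewrite ltnn eqxx.
  by rewrite iks s0.
exists (rcons s a); last by rewrite size_rcons sk.
split; last first.
  apply: eq_koszul_vanish (koszul_vanish_adjoin rk_inj ids areg vs) => f.
  by split=> /colon_smul_rcons.
split=> //; last by exists e; apply: maximal_not_smul.
move=> i; rewrite size_rcons ltnS nth_rcons -cats1 leq_eqVlt => /predU1P[->|iks].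
  by rewrite ltnn eqxx take_size_cat //; apply/regular_modP.
by rewrite iks takel_cat 1?ltnW //; apply: sreg.
Qed.

End CyclicDepth.

(** * Cohomology of families of sets *)

Section Acyclic.
Variables (K : fieldType) (V : finType) (rk : V -> nat).
Hypothesis rk_inj : injective rk.
Implicit Types (A C : {set V}) (f g h : {set V} -> K) (F P : pred {set V}).

Notation delta := (cobd rk (fun=> 1)).

Definition supported_on F f := forall A, ~~ F A -> f A = 0.

(** Cochains supported on [F] have no cohomology in degree [j], where degrees
    are cardinals.  For a simplicial complex this is reduced cohomology, with
    degrees raised by one. *)
Definition acyclic F j :=
  forall f, supported_on F f ->
    (forall A, F A -> #|A| = j.+1 -> delta f A = 0) ->
  exists2 g, supported_on F g & forall A, F A -> #|A| = j -> f A = delta g A.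

Definition convex_family F :=
  forall A (B : {set V}) C, F A -> F C -> A \subset B -> B \subset C -> F B.

Lemma eq_acyclic F F' j : F =1 F' -> acyclic F j -> acyclic F' j.
Proof.
move=> eqF acF f f0 fc; have [|A FA cA|g g0 fg] := acF f.
- by move=> A; rewrite eqF; apply: f0.
- by apply: fc; rewrite -?eqF.
exists g => A; rewrite -eqF; [exact: g0|exact: fg].
Qed.

Lemma acyclic_no_card F j : (forall A, F A -> #|A| <> j) -> acyclic F j.
Proof. by move=> noF f _ _; exists (fun=> 0) => // A /noF. Qed.

(** A family that is invariant under adding or removing [v] is a cone. *)
Lemma acyclic_toggle v F j :
  (forall A, v \notin A -> F (v |: A) = F A) -> acyclic F j.
Proof.
move=> togF f f0 fc; exists (contract rk v f) => [A nFA|A FA cA].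
  by rewrite /contract; case: ifPn => // vA; rewrite f0 ?mulr0 // togF.
have := contract_homotopy rk_inj v (fun=> 1) f A; rewrite mul1r => <-.
rewrite /contract; case: ifPn => vA; first by rewrite addr0.
by rewrite fc ?mulr0 ?addr0 ?togF // cardsU1 vA cA.
Qed.

Definition truncate F f A := if F A then f A else 0.

Lemma truncate_supported F f : supported_on F (truncate F f).
Proof. by move=> A; rewrite /truncate => /negPf ->. Qed.

(** A set between two members of [F] is a member, so the truncation removes no
    term from [cobd (cobd h)]. *)
Lemma cobd_truncate_cobd F h A : convex_family F -> supported_on F h -> F A ->
  delta (truncate F (delta h)) A = 0.
Proof.
move=> cvF h0 FA; rewrite -[RHS](cobdK rk_inj (fun=> 1) h A).
apply: eq_cobd => i iA; rewrite /truncate; case: ifPn => // nF.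
rewrite /cobd big1 // => k kA; rewrite h0 ?mulr0 //.
apply: contra nF => Fk; apply: cvF Fk FA _ _; first exact: subsetDl.
exact: subsetDl.
Qed.

Definition up_in F P := forall A C, F A -> F C -> A \subset C -> P A -> P C.

(** The cochains supported on the members that satisfy [P] form a subcomplex;
    this is exactness of the long exact sequence in the middle. *)
Lemma acyclic_split F P j : convex_family F -> up_in F P ->
  acyclic (fun A => F A && ~~ P A) j -> acyclic (fun A => F A && P A) j ->
  acyclic F j.
Proof.
move=> cvF upP acN acP f f0 fc.
have truncateN u A : supported_on F u -> F A && ~~ P A ->
    delta (truncate (fun A => F A && ~~ P A) u) A = delta u A.
  move=> u0 /andP[FA nPA]; apply: eq_cobd => i iA; rewrite /truncate.
  case: ifPn => //; rewrite negb_and negbK => /orP[/u0 -> //|PAi].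
  have [FAi|/u0 -> //] := boolP (F (A :\ i)).
  by rewrite (upP _ _ FAi FA (subsetDl _ _) PAi) in nPA.
have [||g g0 fg] := acN (truncate (fun A => F A && ~~ P A) f).
- exact: truncate_supported.
- by move=> A FPA cA; rewrite truncateN // fc //; case/andP: FPA.
have gF : supported_on F g by move=> A nF; rewrite g0 //= negb_and nF.
pose f' A := truncate F (fun A => f A - delta g A) A.
have f'N A : #|A| = j -> ~~ P A -> f' A = 0.
  move=> cA nPA; rewrite /f' /truncate; case: ifPn => // FA.
  have FPA : F A && ~~ P A by rewrite FA.
  by rewrite -fg // /truncate FPA subrr.
have f'P A : #|A| = j -> truncate (fun A => F A && P A) f' A = f' A.
  move=> cA; rewrite {1}/truncate; case: ifPn => //; rewrite negb_and => /orP[nF|nP].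
    by rewrite /f' /truncate (negPf nF).
  by rewrite f'N.
have [||h h0 f'h] := acP (truncate (fun A => F A && P A) f').
- exact: truncate_supported.
- move=> A /andP[FA PA] cA.
  rewrite (@eq_cobd _ _ _ _ _ f') => [|i iA]; last by rewrite f'P // (card_setD1S cA).
  transitivity (delta (fun C => f C - truncate F (delta g) C) A).
    apply: eq_cobd => i iA; rewrite /f' /truncate; case: ifPn => // /f0 ->.
    by rewrite subr0.
  by rewrite cobdB fc // cobd_truncate_cobd // subrr.
exists (fun A => g A + h A) => [A nF|A FA cA].
  by rewrite gF // h0 ?addr0 //= negb_and nF.
rewrite cobdD.
have [PA|nPA] := boolP (P A).
  rewrite -f'h ?FA // f'P // /f' /truncate FA; by rewrite addrC subrK.
have FPA : F A && ~~ P A by rewrite FA.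
rewrite -fg // /truncate FPA [delta h A]big1 ?addr0 // => i iA.
rewrite h0 ?mulr0 //; apply: contra nPA => /andP[FAi PAi].
exact: upP FAi FA (subsetDl _ _) PAi.
Qed.

(** The connecting homomorphism: the cohomology of the upper part is squeezed
    between that of the lower part and that of the whole family. *)
Lemma acyclic_upper F P j : convex_family F -> up_in F P ->
  acyclic F j.+1 -> acyclic (fun A => F A && ~~ P A) j ->
  acyclic (fun A => F A && P A) j.+1.
Proof.
move=> cvF upP acF acN f f0 fc.
have [||g g0 fg] := acF f.
- by move=> A nF; rewrite f0 //= negb_and nF.
- move=> A FA cA; have [PA|nPA] := boolP (P A); first by rewrite fc ?FA.
  rewrite /cobd big1 // => i iA; rewrite f0 ?mulr0 //; apply: contra nPA.
  by move=> /andP[FAi]; apply: upP => //; apply: subsetDl.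
have [||h h0 gh] := acN (truncate (fun A => F A && ~~ P A) g).
- exact: truncate_supported.
- move=> A /andP[FA nPA] cA.
  rewrite (@eq_cobd _ _ _ _ _ g) => [|i iA].
    by rewrite -fg // f0 //= negb_and nPA orbT.
  rewrite /truncate; case: ifPn => //; rewrite negb_and negbK => /orP[/g0 -> //|PAi].
  have [FAi|/g0 -> //] := boolP (F (A :\ i)).
  by rewrite (upP _ _ FAi FA (subsetDl _ _) PAi) in nPA.
exists (truncate (fun A => F A && P A) (fun A => g A - delta h A)).
  exact: truncate_supported.
move=> A /andP[FA PA] cA.
have hF : supported_on F h by move=> C nF; rewrite h0 //= negb_and nF.
transitivity (delta (fun C => g C - truncate F (delta h) C) A).
  by rewrite cobdB cobd_truncate_cobd // subr0 fg.
apply: eq_cobd => i iA; have cAi := card_setD1S cA iA; rewrite /truncate.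
case: ifPn => [FAi|nFAi] /=; last by rewrite g0 // subr0.
case: ifPn => // nPAi; have FPAi : F (A :\ i) && ~~ P (A :\ i) by rewrite FAi.
by have := gh _ FPAi cAi; rewrite /truncate FPAi => ->; rewrite subrr.
Qed.

(** Filtration along a monotone labelling: the labels are peeled off from
    the maximal ones downwards. *)
Lemma acyclic_fibers (W : finType) (lab : {set V} -> {set W}) F j :
  convex_family F ->
  (forall A C, F A -> F C -> A \subset C -> lab A \subset lab C) ->
  (forall L, acyclic (fun A => F A && (lab A == L)) j) -> acyclic F j.
Proof.
move=> cvF labS acL.
suff H (S : {set {set W}}) : (forall L L' : {set W}, L \in S -> L' \subset L -> L' \in S) ->
    acyclic (fun A => F A && (lab A \in S)) j.
  apply: eq_acyclic (H setT _) => [A|L L' _ _]; by rewrite !inE ?andbT.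
move: {2}_.+1 (ltnSn #|S|) => N; elim: N S => // N IHN S; rewrite ltnS => cS dwS.
have [->|[L0 L0S]] := set_0Vmem S.
  by apply: acyclic_no_card => A; rewrite inE andbF.
pose L := [arg max_(L' > L0 in S) #|L'|].
have [LS Lmax] : L \in S /\ forall L' : {set W}, L' \in S -> (#|L'| <= #|L|)%N.
  by rewrite /L; case: arg_maxnP.
have cvS : convex_family (fun A => F A && (lab A \in S)).
  move=> A B C /andP[FA AS] /andP[FC CS] AB BC; have FB := cvF _ _ _ FA FC AB BC.
  by rewrite FB; apply: dwS CS _; apply: labS.
apply: (acyclic_split (P := fun A => lab A == L)) => //.
- move=> A C /andP[FA AS] /andP[FC CS] AC /eqP labA.
  by rewrite eq_sym -labA eqEcard labS //= labA Lmax.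
- apply: eq_acyclic (IHN (S :\ L) _ _) => [A||L1 L2].
  + by rewrite in_setD1 [X in _ && X]andbC andbA.
  + by move: cS; rewrite (cardsD1 L) LS.
  rewrite !inE => /andP[neL L1S] L21; rewrite (dwS _ _ L1S L21) andbT.
  apply: contraNneq neL => L2L; move: L21; rewrite L2L => LL1.
  by rewrite eq_sym eqEcard LL1 Lmax.
- apply: eq_acyclic (acL L) => A; rewrite -andbA; congr (_ && _).
  by case: eqP => [->|]; rewrite ?LS ?andbF.
Qed.
End Acyclic.

(** Both [F] and [F'] have the same complex up to the shift by [#|W|], if the
    members of [F] are the disjoint unions of [W] with images of members
    of [F']. *)
Section Shift.
Variables (K : fieldType) (V V' : finType) (rk : V -> nat) (iota : V' -> V).
Hypothesis iota_inj : injective iota.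
Variables (W : {set V}) (F : pred {set V}) (F' : pred {set V'}).
Hypothesis F'F : forall D, F' D -> F (W :|: iota @: D).
Hypothesis FF' : forall A, F A -> exists2 D, F' D & A = W :|: iota @: D.
Hypothesis disjW : forall D, F' D -> [disjoint W & iota @: D].

Notation delta := (cobd (R := K) rk (fun=> 1)).
Notation delta' := (cobd (R := K) (rk \o iota) (fun=> 1)).

(** The sign of moving the elements of [D] past those of [W]. *)
Definition twist (D : {set V'}) : K :=
  \prod_(x in D) (-1) ^+ #|[set w in W | (rk w < rk (iota x))%N]|.

Definition pull (f : {set V} -> K) := truncate F' (fun D => twist D * f (W :|: iota @: D)).

Lemma twistK D : twist D * twist D = 1.
Proof.
by rewrite /twist -big_split big1 //= => x _; rewrite -expr2 sqrr_sign.
Qed.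

Lemma shift_unique (D E : {set V'}) : F' D -> [disjoint W & iota @: E] ->
  W :|: iota @: D = W :|: iota @: E -> D = E.
Proof.
move=> /disjW dD dE eDE; apply: (imset_inj iota_inj).
have sub (B : {set V'}) : [disjoint W & iota @: B] -> iota @: B = (W :|: iota @: B) :\: W.
  by move=> dB; rewrite setDUl setDv set0U; apply/esym/setDidPl; rewrite disjoint_sym.
by rewrite (sub D) // eDE -sub.
Qed.

(** Removing an element of [W] leaves [F], so that only the elements of [D]
    contribute. *)
Lemma cobd_shift f D : supported_on F f -> F' D ->
  delta f (W :|: iota @: D) = twist D * delta' (pull f) D.
Proof.
move=> f0 FD; have dD := disjW FD.
have iW x : x \in D -> iota x \notin W.
  by move=> xD; rewrite (disjointFl dD) // imset_f.
rewrite /cobd (eq_bigl [predU W & iota @: D]) => [|x]; last by rewrite !inE.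
rewrite bigU //= big1 ?add0r => [|w wW]; last first.
  rewrite f0 ?mulr0 //; apply/negP => /FF'[E _ /setP/(_ w)].
  by rewrite !inE eqxx wW.
rewrite big_imset /= => [|x y _ _]; last exact: iota_inj.
rewrite mulr_sumr; apply: eq_bigr => x xD.
have eD : (W :|: iota @: D) :\ iota x = W :|: iota @: (D :\ x).
  rewrite setDUl (_ : W :\ iota x = W); last first.
    by apply/setDidPl; rewrite disjoint_sym disjoints1 iW.
  congr (_ :|: _); apply/setP => v; rewrite !inE; apply/andP/imsetP.
    move=> [nev /imsetP[u uD vE]]; exists u => //; rewrite !inE uD andbT.
    by apply: contraNneq nev => <-; rewrite vE.
  move=> [u]; rewrite !inE => /andP[neu uD] ->.
  by rewrite (inj_eq iota_inj) imset_f.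
have -> : pull f (D :\ x) = twist (D :\ x) * f ((W :|: iota @: D) :\ iota x).
  rewrite /pull /truncate eD; case: ifPn => // nF'; rewrite f0 ?mulr0 //.
  apply: contra nF' => /FF'[E FE eE]; rewrite (_ : D :\ x = E) //.
  apply/esym/shift_unique => //; apply: disjointWr dD; apply: imsetS.
  exact: subsetDl.
have -> : ksign K rk (iota x) (W :|: iota @: D) =
    (-1) ^+ #|[set w in W | (rk w < rk (iota x))%N]| * ksign K (rk \o iota) x D.
  rewrite /ksign -exprD; congr (_ ^+ _).
  rewrite -(card_imset [set j in D | _] iota_inj) -cardsUI.
  rewrite [X in _ = (_ + #|pred_of_set X|)%N](_ : _ = set0) ?cards0 ?addn0.
    congr #|pred_of_set _|; apply/setP => v; rewrite !inE andb_orl; congr (_ || _).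
    apply/andP/imsetP => [[/imsetP[u uD ->] lt]|[u]].
      by exists u; rewrite // inE uD.
    by rewrite inE => /andP[uD lt] ->; rewrite imset_f.
  apply/setP => v; rewrite !inE; apply/negP => /andP[/andP[vW _] /imsetP[u]].
  by rewrite inE => /andP[uD _] e; move: (iW u uD); rewrite -e vW.
rewrite [twist D](big_setD1 x) //= -/(twist _) !mul1r.
set t := twist _; set s := _ ^+ _; set k := ksign _ _ _ _; set u := f _.
by rewrite -[LHS]mul1r -(twistK (D :\ x)) -/t; ring.
Qed.

Definition unshift A := iota @^-1: (A :\: W).

Lemma unshiftK D : F' D -> unshift (W :|: iota @: D) = D.
Proof.
move=> FD; apply/setP => x; rewrite !inE mem_imset // andbC.
have [xD|] := boolP (x \in D); last by rewrite orbF => _; case: (_ \in W).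
by rewrite orbT (disjointFl (disjW FD)) // imset_f.
Qed.

Definition push (g : {set V'} -> K) := truncate F (fun A => twist (unshift A) * g (unshift A)).

Lemma pullK g : supported_on F' g -> pull (push g) =1 g.
Proof.
move=> g0 D; rewrite /pull /truncate; case: ifPn => [FD|/g0 -> //].
by rewrite /push /truncate F'F // unshiftK // mulrA twistK mul1r.
Qed.

Lemma card_shift D : F' D -> #|W :|: iota @: D| = (#|W| + #|D|)%N.
Proof.
move=> /disjW dD; rewrite cardsU (card_imset _ iota_inj).
by move: dD; rewrite -setI_eq0 => /eqP->; rewrite cards0 subn0.
Qed.

(** The signs of the two complexes agree up to the cochain automorphism
    [twist]. *)
Lemma acyclic_shift j : acyclic K (rk \o iota) F' j -> acyclic K rk F (#|W| + j).
Proof.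
move=> acF' f f0 fc; have [||g g0 fg] := acF' (pull f).
- exact: truncate_supported.
- move=> D FD cD; rewrite -[LHS]mul1r -[X in X * _](twistK D) -mulrA -cobd_shift //.
  by rewrite fc ?mulr0 ?F'F // card_shift // cD addnS.
exists (push g); first exact: truncate_supported.
move=> A FA cA; have [D FD AE] := FF' FA; rewrite AE cobd_shift //; last first.
  exact: truncate_supported.
rewrite (@eq_cobd _ _ _ _ _ g) => [|i _]; last by rewrite pullK.
rewrite -fg //; last by apply/eqP; rewrite -(eqn_add2l #|W|) -card_shift // -AE cA.
by rewrite /pull /truncate FD mulrA twistK mul1r.
Qed.

Lemma acyclic_unshift j : acyclic K rk F (#|W| + j) -> acyclic K (rk \o iota) F' j.
Proof.
move=> acF f f0 fc; have [||g g0 fg] := acF (push f).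
- exact: truncate_supported.
- move=> A FA cA; have [D FD AE] := FF' FA; rewrite AE cobd_shift //; last first.
    exact: truncate_supported.
  rewrite (@eq_cobd _ _ _ _ _ f) => [|i _]; last by rewrite pullK.
  rewrite fc ?mulr0 //; apply/eqP.
  by rewrite -(eqn_add2l #|W|) -card_shift // -AE cA addnS.
exists (pull g); first exact: truncate_supported.
move=> D FD cD; rewrite -[RHS]mul1r -[X in X * _](twistK D) -mulrA -cobd_shift //.
rewrite -fg ?F'F // ?card_shift ?cD // -[LHS](pullK f0).
by rewrite /pull /truncate FD.
Qed.
End Shift.

(** * Hochster's formula *)

Section Hochster.
Variables (K : fieldType) (V : finType) (F : pred {set V}).
Local Notation R := {mpoly K[#|V|]}.
Local Notation var := (fun v : V => 'X_(enum_rank v) : R).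
Implicit Types (m alpha : 'X_{1..#|V|}) (A Z : {set V}).

Hypothesis F_down : forall A C : {set V}, C \subset A -> F A -> F C.

Definition msupport m : {set V} := [set v | m (enum_rank v) != 0%N].

(** The Stanley-Reisner ideal of the complex [F]. *)
Definition sr_ideal (f : R) := forall m, F (msupport m) -> f@_m = 0.

Definition translate Z : pred {set V} := fun A => (Z \subset A) && F (A :\: Z).

(** This is the vanishing of the Koszul strands in the multidegrees with entries
    [0] and [-1] only, [Z] being the set of the entries [-1]. *)
Definition hochster d := forall (rk : V -> nat) Z i, injective rk -> (i < d)%N ->
  acyclic K rk (translate Z) i.

Definition mdeg0 alpha : {set V} := [set v | alpha (enum_rank v) == 0%N].
Definition mdeg2 alpha : {set V} := [set v | (1 < alpha (enum_rank v))%N].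

(** In the strand of multidegree [a], a cochain takes at [A] the value of a
    coefficient at the exponent [a + 1_A].  As [a >= -1], the strand is indexed
    by [alpha = a + 1]; [shift_mon alpha A] is [a + 1_A], except that the
    subtraction is truncated where [alpha] is [0] outside [A], a case that
    [graded_family] excludes. *)
Definition shift_mon alpha A : 'X_{1..#|V|} :=
  [multinom (alpha i + (enum_val i \in A) - 1)%N | i < #|V|].

Definition unshift_mon A m : 'X_{1..#|V|} :=
  [multinom (m i + 1 - (enum_val i \in A))%N | i < #|V|].

Definition graded_family alpha : pred {set V} :=
  fun A => (mdeg0 alpha \subset A) && F (mdeg2 alpha :|: (A :\: mdeg0 alpha)).

Lemma shift_monE alpha A v :
  shift_mon alpha A (enum_rank v) = (alpha (enum_rank v) + (v \in A) - 1)%N.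
Proof. by rewrite mnmE enum_rankK. Qed.

Lemma unshift_monK A m : shift_mon (unshift_mon A m) A = m.
Proof. by apply/mnmP => i; rewrite !mnmE; case: (_ \in A) => /=; lia. Qed.

Lemma mdeg0_unshift A m : mdeg0 (unshift_mon A m) \subset A.
Proof.
apply/subsetP => v; rewrite inE mnmE enum_rankK; case: (_ \in A) => //.
by rewrite addn1.
Qed.

Lemma shift_monK alpha A : mdeg0 alpha \subset A ->
  unshift_mon A (shift_mon alpha A) = alpha.
Proof.
move=> /subsetP zA; apply/mnmP => i; rewrite !mnmE.
have := zA (enum_val i); rewrite inE enum_valK; case: (enum_val i \in A) => /=; first by lia.
by case: (alpha i) => [/(_ isT)|n _] //; lia.
Qed.

Lemma msupport_shift alpha A : mdeg0 alpha \subset A ->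
  msupport (shift_mon alpha A) = mdeg2 alpha :|: (A :\: mdeg0 alpha).
Proof.
move=> /subsetP zA; apply/setP => v; rewrite !inE shift_monE.
have := zA v; rewrite inE; case: (v \in A) => /= H; first by lia.
by case: (alpha _) H => [/(_ isT)|n _] //; lia.
Qed.

Lemma mcoeff_sign k (p : R) m : ((-1) ^+ k * p)@_m = (-1) ^+ k * p@_m.
Proof.
by elim: k p => [|k IHk] p; rewrite ?expr0 ?mul1r // !exprS -!mulrA !mulN1r mcoeffN IHk.
Qed.

Lemma mcoeff_XM (i : 'I_#|V|) (p : R) m :
  ('X_i * p)@_m = if m i == 0%N then 0 else p@_(m - U_(i))%MM.
Proof.
case: eqP => [mi0|/eqP mi].
  apply: memN_msupp_eq0; rewrite mulrC (perm_mem (msuppMX p _)).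
  by apply/mapP => -[m' _ mE]; move: mi0; rewrite mE mnmE mnm1E eqxx.
have le1 : (U_(i) <= m)%MM.
  by apply/mnm_lepP => j; rewrite mnm1E; case: eqP => [<-|//]; rewrite lt0n.
by rewrite mulrC -{1}(submK le1) addmC mcoeffMX.
Qed.

Definition strand alpha (f : {set V} -> R) : {set V} -> K :=
  truncate (graded_family alpha) (fun A => (f A)@_(shift_mon alpha A)).

(** The strands of the Koszul complex are complexes of families of sets. *)
Lemma mcoeff_cobd rk (f : {set V} -> R) alpha A : graded_family alpha A ->
  (cobd rk var f A)@_(shift_mon alpha A) = cobd rk (fun=> 1) (strand alpha f) A.
Proof.
move=> gA; have /andP[zA FA] := gA; rewrite /cobd raddf_sum /=; apply: eq_bigr => v vA.
rewrite mcoeff_sign mul1r mcoeff_XM; congr (_ * _); rewrite shift_monE vA /=.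
rewrite addnK; case: ifPn => [a0|a0].
  rewrite /strand /truncate /graded_family; case: ifP => // /andP[/subsetP/(_ v)].
  by rewrite !inE eqxx a0 => /(_ isT).
have gAv : graded_family alpha (A :\ v).
  rewrite /graded_family subsetD1 zA inE a0 /=; apply: F_down FA.
  by apply: setUS; apply: setSD; apply: subsetDl.
rewrite /strand /truncate gAv; congr (_@__); apply/mnmP => i; rewrite !mnmE !inE.
have -> : (enum_val i == v) = (enum_rank v == i).
  by rewrite -(inj_eq enum_rank_inj) enum_valK eq_sym.
case: eqP => [<-|_] /=; last by rewrite subn0.
by rewrite enum_rankK vA; lia.
Qed.

(** A vertex of positive degree in [a] lies in the support of the monomial
    whether or not it is in [A], so the strand is a cone; otherwise the entries
    of [a] are [0] and [-1]. *)
Lemma graded_acyclic rk alpha d i : injective rk -> hochster d -> (i < d)%N ->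
  acyclic K rk (graded_family alpha) i.
Proof.
move=> rk_inj hF id; have [P0|[v v2]] := set_0Vmem (mdeg2 alpha).
  by apply: eq_acyclic (hF rk (mdeg0 alpha) i rk_inj id) => A; rewrite /graded_family P0 set0U.
have vz : v \notin mdeg0 alpha by move: v2; rewrite !inE -lt0n => /ltnW.
apply: (acyclic_toggle rk_inj (v := v)) => // A vA; rewrite /graded_family.
congr (_ && F _); last first.
  by apply/setP => u; rewrite !inE; case: (u =P v) => [->|//]; move: v2; rewrite !inE => v2; rewrite v2.
apply/subsetP/subsetP => sub u uz; have := sub u uz; rewrite in_setU1.
  by case: (u =P v) uz => [->|//]; rewrite (negPf vz).
by move=> ->; rewrite orbT.
Qed.

(** A Koszul cochain is assembled from potentials of its strands; the strands
    that meet the support of the given cocycle suffice. *)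
Lemma hochster_koszul rk d : injective rk -> hochster d ->
  koszul_vanish rk var sr_ideal d.
Proof.
move=> rk_inj hF f i id fc.
have potential alpha : exists c : {set V} -> K, supported_on (graded_family alpha) c /\
    forall A, graded_family alpha A -> #|A| = i ->
      strand alpha f A = cobd rk (fun=> 1) c A.
  have [||c c0 fE] := @graded_acyclic rk alpha d i rk_inj hF id (strand alpha f).
  - exact: truncate_supported.
  - move=> A gA cA; rewrite -mcoeff_cobd //; apply: fc => //.
    by case/andP: gA => zA FA; rewrite msupport_shift.
  by exists c.
have [c cP] := choice potential.
pose S := undup (flatten [seq [seq unshift_mon A m | m <- msupp (f A)] | A : {set V}]).
pose g A : R := \sum_(alpha <- S) c alpha A *: 'X_[shift_mon alpha A].
have gE alpha A : mdeg0 alpha \subset A ->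
    (g A)@_(shift_mon alpha A) = if alpha \in S then c alpha A else 0.
  move=> zA; rewrite /g raddf_sum /=.
  have termE beta : (c beta A *: 'X_[shift_mon beta A] : R)@_(shift_mon alpha A) =
      if beta == alpha then c alpha A else 0.
    rewrite mcoeffZ mcoeffX; case: eqP => [e|ne].
      have [gb|ngb] := boolP (graded_family beta A).
        have -> : beta = alpha by rewrite -(shift_monK zA) -e shift_monK //; case/andP: gb.
        by rewrite eqxx mulr1.
      rewrite (proj1 (cP beta)) // mul0r; case: eqP => // eb.
      by rewrite -eb (proj1 (cP beta)).
    by rewrite mulr0; case: eqP => // eb; case: ne; rewrite eb.
  under eq_bigr do rewrite termE.
  case: ifPn => aS.
    rewrite (bigD1_seq alpha) ?undup_uniq //= eqxx big1 ?addr0 // => beta.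
    by move=> /negPf ->.
  rewrite big_seq big1 // => beta bS; case: eqP => // eb.
  by move: aS; rewrite -eb bS.
exists g => A cA m Fm.
pose alpha := unshift_mon A m; have zA : mdeg0 alpha \subset A := mdeg0_unshift A m.
have mE : m = shift_mon alpha A by rewrite unshift_monK.
have gA : graded_family alpha A by rewrite /graded_family zA -msupport_shift // -mE.
have strandg C : strand alpha g C = if alpha \in S then c alpha C else 0.
  rewrite /strand /truncate; case: ifPn => [/andP[zC _]|nC]; first exact: gE.
  by rewrite (proj1 (cP alpha)) // if_same.
rewrite mcoeffB [in X in _ - X]mE mcoeff_cobd //.
case: (boolP (alpha \in S)) strandg => aS strandg.
  rewrite (@eq_cobd _ _ _ _ _ (c alpha)) => [|v _]; last by rewrite strandg.
  by rewrite -(proj2 (cP alpha)) // /strand /truncate gA -mE subrr.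
rewrite /cobd big1 => [|v _]; last by rewrite strandg !mulr0.
rewrite subr0; apply: memN_msupp_eq0; apply: contra aS => mf.
rewrite mem_undup; apply/flattenP; exists [seq unshift_mon A m' | m' <- msupp (f A)].
  by apply/imageP; exists A.
exact: map_f.
Qed.

(** A cocycle on one strand extends by zero to a Koszul cocycle, and the strand
    of a potential of the latter is a potential of the former. *)
Lemma koszul_hochster d : (forall rk : V -> nat, injective rk ->
  koszul_vanish rk var sr_ideal d) -> hochster d.
Proof.
move=> vF rk Z i rk_inj id f f0 fc.
pose alpha : 'X_{1..#|V|} := [multinom ((enum_val i \notin Z) : nat) | i < #|V|].
have a0 : mdeg0 alpha = Z.
  by apply/setP => v; rewrite inE mnmE enum_rankK; case: (v \in Z).
have a2 : mdeg2 alpha = set0.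
  by apply/setP => v; rewrite !inE mnmE enum_rankK; case: (v \in Z).
have gZ A : graded_family alpha A = translate Z A.
  by rewrite /graded_family a0 a2 set0U.
pose f' A : R := f A *: 'X_[shift_mon alpha A].
have strandf A : strand alpha f' A = f A.
  rewrite /strand /truncate gZ; case: ifPn => [_|/f0 -> //].
  by rewrite mcoeffZ mcoeffX eqxx mulr1.
have [|g fg] := vF rk rk_inj f' i id.
  move=> A cA m Fm; pose beta := unshift_mon A m.
  have zA : mdeg0 beta \subset A := mdeg0_unshift A m.
  have mE : m = shift_mon beta A by rewrite unshift_monK.
  have gA : graded_family beta A by rewrite /graded_family zA -msupport_shift // -mE.
  rewrite mE mcoeff_cobd //; have [ba|ba] := eqVneq beta alpha.
    rewrite ba; rewrite (@eq_cobd _ _ _ _ _ f) => [|v _]; last by rewrite strandf.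
    by apply: fc => //; rewrite -gZ -ba.
  rewrite /cobd big1 // => v vA; rewrite [strand _ _ _](_ : _ = 0) ?mulr0 //.
  rewrite /strand /truncate; case: ifP => // /andP[zAv _].
  rewrite mcoeffZ mcoeffX; case: eqP => [e|_]; last by rewrite mulr0.
  have [tA|/f0 ->] := boolP (translate Z (A :\ v)); last by rewrite mul0r.
  case/eqP: ba; rewrite -(shift_monK zAv) -e shift_monK //.
  by rewrite a0; case/andP: tA.
exists (strand alpha g) => [A nA|A tA cA]; first by apply: truncate_supported; rewrite gZ.
have gA : graded_family alpha A by rewrite gZ.
have zA : mdeg0 alpha \subset A by case/andP: gA.
rewrite -mcoeff_cobd // -strandf /strand /truncate gA; apply/eqP; rewrite -subr_eq0.
rewrite -mcoeffB; apply/eqP/fg => //.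
by rewrite msupport_shift //; case/andP: gA.
Qed.

End Hochster.

(** * Edge rings *)

Lemma is_max_maxP P d : is_max P d -> maxP P = d.
Proof.
move=> maxd; rewrite /maxP; case: pselect => [h|[]]; last by exists d.
have [Pe maxe] := projT2 (cid h); case: maxd => Pd maxd.
by apply/anti_leq; rewrite maxd // maxe.
Qed.

Lemma bounded_is_max (P : nat -> Prop) b d0 :
  P d0 -> (forall d, P d -> (d <= b)%N) -> exists d, is_max P d.
Proof.
move=> Pd0 Pb; suff: forall k d, P d -> (b <= d + k)%N -> exists d, is_max P d.
  by move=> /(_ b d0 Pd0); apply; apply: leq_addl.
elim=> [|k IHk] d Pd bd.
  by exists d; split=> // e /Pb; rewrite addn0 in bd; move=> /leq_trans; apply.
have [[e Pe de]|nmax] := pselect (exists2 e, P e & (d < e)%N).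
  by apply: IHk Pe _; apply: leq_trans bd _; rewrite addnS -addSn leq_add2r.
exists d; split=> // e Pe; rewrite leqNgt; apply/negP => de.
by apply: nmax; exists e.
Qed.

(** Isolated vertices are excluded since their variables belong to the edge
    ideal. *)
Definition face (G : sgraph) : pred {set G} := fun A =>
  [forall x in A, (x \notin isolated G) && [forall y in A, ~~ edge x y]].

Lemma faceP (G : sgraph) (A : {set G}) :
  reflect (forall x, x \in A -> x \notin isolated G /\ forall y, y \in A -> ~~ edge x y)
          (face A).
Proof.
apply: (iffP forall_inP) => H x xA.
  by have /andP[nx /forall_inP] := H x xA.
by have [-> Hx] := H x xA; apply/forall_inP.
Qed.

Lemma face_sub (G : sgraph) (A C : {set G}) : C \subset A -> face A -> face C.
Proof.
move=> /subsetP CA /faceP fA; apply/faceP => x /CA /fA[nx Hx].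
by split=> // y /CA; apply: Hx.
Qed.

Section EdgeRing.
Variables (K : fieldType) (G : sgraph).
Local Notation R := {mpoly K[#|G|]}.
Local Notation I := (@edge_ideal K G).
Local Notation gens := (edge_gens K G).

Lemma is_ideal_edge : is_ideal (fun f : R => f \in I).
Proof.
have [I0 _ Ilin] := edge_ideal_closed K G.
split=> //; first by move=> x x' Ix Ix'; rewrite -[x]mul1r; apply: Ilin.
by move=> c x Ix; rewrite -[_ * _]addr0; apply: Ilin.
Qed.

Lemma edge_gen_in g : g \in gens -> g \in I.
Proof.
move=> gg; have ig : (index g gens < size gens)%N by rewrite index_mem.
apply/asboolP; exists (fun i => (i == Ordinal ig)%:R).
rewrite (bigD1 (Ordinal ig)) //= eqxx mul1r nth_index // big1 ?addr0 //.
by move=> i /negPf ->; rewrite mul0r.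
Qed.

Lemma mpolyX_mul_xvar (m : 'X_{1..#|G|}) (x : G) : m (enum_rank x) != 0%N ->
  'X_[m] = 'X_[(m - U_(enum_rank x))%MM] * xvar K x.
Proof.
move=> mx; rewrite /xvar -mpolyXD submK //; apply/mnm_lepP => j.
by rewrite mnm1E; case: eqP => [<-|//]; rewrite lt0n.
Qed.

(** The edge ideal is spanned by monomials: those with a generator as a factor. *)
Lemma edge_idealP (f : R) : f \in I <-> sr_ideal (@face G) f.
Proof.
split=> [/asboolP[c ->] m fm|fF]; last first.
  rewrite [f]mpolyE; apply: (ideal_sum is_ideal_edge) => m _.
  have [fm|nfm] := boolP (face (msupport m)).
    by rewrite fF // scale0r; apply: ideal0 is_ideal_edge.
  rewrite -mul_mpolyC; apply: (idealMl is_ideal_edge).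
  move: nfm; rewrite negb_forall_in => /exists_inP[x]; rewrite inE => mx.
  rewrite negb_and negbK => /orP[ix|].
    rewrite (mpolyX_mul_xvar mx); apply: (idealMl is_ideal_edge).
    by apply: edge_gen_in; rewrite mem_cat; apply/orP; right; apply/imageP; exists x.
  rewrite negb_forall_in => /exists_inP[y]; rewrite inE => my; rewrite negbK => xy.
  have nxy : enum_rank x != enum_rank y.
    by rewrite (inj_eq enum_rank_inj); apply: contraTneq xy => ->; rewrite edge_irr.
  rewrite (mpolyX_mul_xvar mx) (@mpolyX_mul_xvar _ y); last first.
    by rewrite mnmBE mnm1E (negPf nxy) subn0.
  rewrite -mulrA; apply: (idealMl is_ideal_edge); apply: edge_gen_in.
  rewrite mem_cat; apply/orP; left; apply/imageP; exists (y, x) => //.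
  by rewrite inE /= edge_sym.
rewrite raddf_sum big1 //= => i _.
have : gens`_i \in gens by rewrite mem_nth.
have xvarE x (p : R) m' : (p * xvar K x)@_m' = if m' (enum_rank x) == 0%N then 0
    else p@_(m' - U_(enum_rank x))%MM by rewrite mulrC mcoeff_XM.
move/faceP: fm => fm; rewrite mem_cat => /orP[/imageP[[x y] xy ->]|/imageP[x ix ->]].
  move: xy; rewrite inE /= => xy; rewrite mulrA xvarE; case: ifPn => // my.
  rewrite xvarE; case: ifPn => // mx.
  have ym : y \in msupport m by rewrite inE.
  have xm : x \in msupport m.
    by rewrite inE; move: mx; rewrite mnmBE; apply: contraNneq => ->.
  by have [_ /(_ y ym)] := fm x xm; rewrite xy.
rewrite xvarE; case: ifPn => // mx.
by have [|] := fm x; rewrite ?inE // => /negP[]; move: ix; rewrite inE.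
Qed.

Local Notation M := (edge_ring K G).
Definition edge_one : M := \pi_{ideal_quot I} 1.

Lemma scale_edge_one (f : R) : f *: edge_one = \pi_{ideal_quot I} f :> M.
Proof. by rewrite /edge_one; transitivity (\pi_{ideal_quot I} f * \pi_{ideal_quot I} 1); rewrite // -rmorphM mulr1. Qed.

Lemma edge_ring_gen (x : M) : exists f : R, x = f *: edge_one.
Proof. by exists (repr x); rewrite scale_edge_one reprK. Qed.

Lemma pi_edge_eq0 (f : R) : \pi_{ideal_quot I} f = 0 :> M <-> f \in I.
Proof.
rewrite -[0 : M]/(0 : {ideal_quot I}) -(rmorph0 (\pi_{ideal_quot I})).
by split=> [/eqP|fI]; [|apply/eqP]; rewrite -Quotient.idealrBE subr0.
Qed.

Lemma edge_ring_ann (f : R) : f *: edge_one = 0 <-> sr_ideal (@face G) f.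
Proof. by rewrite scale_edge_one pi_edge_eq0 edge_idealP. Qed.

Lemma face0 : face (set0 : {set G}).
Proof. by apply/faceP => x; rewrite inE. Qed.

Lemma edge_ring_ann0 (f : R) : f *: edge_one = 0 -> f@_0%MM = 0.
Proof.
move=> /edge_ring_ann; apply; rewrite (_ : msupport _ = set0) ?face0 //.
by apply/setP => v; rewrite !inE mnm0E.
Qed.

Lemma maximal_gen (f : R) : f@_0%MM = 0 <-> exists c, f = \sum_v c v * xvar K v.
Proof.
split=> [f0|[c ->]]; last first.
  rewrite raddf_sum big1 //= => v _; rewrite mulrC mcoeff_XM mnm0E eqxx //.
have idm : is_ideal (fun p : R => exists c, p = \sum_v c v * xvar K v).
  split.
  - by exists (fun=> 0); rewrite big1 // => v _; rewrite mul0r.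
  - move=> p p' [c ->] [c' ->]; exists (fun v => c v + c' v).
    by rewrite -big_split; apply: eq_bigr => v _; rewrite mulrDl.
  - move=> a p [c ->]; exists (fun v => a * c v).
    by rewrite mulr_sumr; apply: eq_bigr => v _; rewrite mulrA.
rewrite [f]mpolyE; apply: (ideal_sum idm) => m _.
have [->|m0] := eqVneq m 0%MM; first by rewrite f0 scale0r; apply: (ideal0 idm).
have [x mx] : exists x, m (enum_rank x) != 0%N.
  apply: contrapT => nx; case/eqP: m0; apply/mnmP => i; rewrite mnm0E.
  by apply/eqP; apply: contrapT => mi; apply: nx; exists (enum_val i); rewrite enum_valK; apply/negP.
rewrite -mul_mpolyC (mpolyX_mul_xvar mx) mulrA; apply: (idealMl idm).
exists (fun v => (v == x)%:R); rewrite (bigD1 x) //= eqxx mul1r big1 ?addr0 //.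
by move=> v /negPf ->; rewrite mul0r.
Qed.

(** Hochster's formula for edge rings. *)
Lemma depth_hochster d :
  (exists2 s, regular_seq M s & size s = d) <-> hochster K (@face G) d.
Proof.
have face_down : forall A C : {set G}, C \subset A -> face A -> face C by exact: face_sub.
have annE f : colon_smul edge_one [::] f <-> sr_ideal (@face G) f.
  by rewrite /colon_smul in_smul_nil edge_ring_ann.
split=> [[s sreg <-]|hd].
  apply: koszul_hochster => // rk rk_inj; apply: eq_koszul_vanish annE _.
  exact: (regular_seq_koszul rk_inj edge_ring_gen maximal_gen).
pose rk (v : G) : nat := enum_rank v.
have rk_inj : injective rk by move=> u v /val_inj/enum_rank_inj.
apply: (koszul_regular_seq rk_inj edge_ring_gen edge_ring_ann0 maximal_gen).
apply: eq_koszul_vanish (hochster_koszul face_down rk_inj hd) => f.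
by rewrite annE.
Qed.

(** For [Z] the set of all vertices, [Z] is the only member of the family, and
    its indicator is a cocycle without potential in degree [#|G|]. *)
Lemma hochster_bound d : hochster K (@face G) d -> (d <= #|G|)%N.
Proof.
move=> hd; rewrite leqNgt; apply/negP => ltd.
pose rk (v : G) : nat := enum_rank v.
have rk_inj : injective rk by move=> u v /val_inj/enum_rank_inj.
have onlyT A : translate (@face G) setT A = (A == setT).
  by rewrite /translate subTset setDT face0 andbT.
have [||g g0 fg] := hd rk setT #|G| rk_inj ltd (fun A => (A == setT)%:R).
- by move=> A; rewrite onlyT => /negPf ->.
- by move=> A _; move: (max_card (mem A)) => /[swap] ->; rewrite ltnn.
have := fg setT; rewrite onlyT eqxx cardsT => /(_ isT erefl)/eqP.
rewrite /cobd big1 ?oner_eq0 // => i _; rewrite g0 ?mulr0 // onlyT.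
by apply/eqP => /setP/(_ i); rewrite !inE eqxx.
Qed.

Lemma edge_depth_is_max : is_max (hochster K (@face G)) (edge_depth K G).
Proof.
have [|d maxd] := bounded_is_max _ hochster_bound (d0 := 0); first by move=> rk Z i.
suff -> : edge_depth K G = d by [].
have [hd dmax] := maxd; apply: is_max_maxP; split; first exact/depth_hochster.
by move=> e /depth_hochster/dmax.
Qed.

End EdgeRing.

(** * Boxes over a family *)

Section Box.
Variables (K : fieldType) (V V' : finType) (iota : V' -> V).
Hypothesis iota_inj : injective iota.
Variables (F' : pred {set V'}) (S : {set V'}) (lo hi : {set V}).
Hypothesis F'S : forall D : {set V'}, F' D -> D \subset S.
Hypothesis lo_hi : lo \subset hi.
Hypothesis hi_core : [disjoint hi & iota @: S].

Definition trace (A : {set V}) : {set V'} := S :&: iota @^-1: A.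

(** The join of the interval from [lo] to [hi] with the copy of the family [F']
    in the image of [S]. *)
Definition box : pred {set V} := fun A =>
  [&& lo \subset A, A \subset hi :|: iota @: S & F' (trace A)].

Lemma in_trace h (A : {set V}) : h \in trace A = (h \in S) && (iota h \in A).
Proof. by rewrite !inE. Qed.

Lemma hi_notin_core u : u \in hi -> u \notin iota @: S.
Proof. by move=> uhi; rewrite (disjointFr hi_core). Qed.

(** If [Z] meets [lo], the translate is empty; if some vertex of [hi :\: lo] is
    not in [Z], it can be toggled and the translate is a cone; otherwise the
    translate is a shift, by at least [#|hi|], of a translate of [F']. *)
Lemma hochster_box t : hochster K F' t -> hochster K box (t + #|hi|).
Proof.
move=> hF rk Z i rk_inj ilt.
have [/set0Pn[u]|] := boolP (Z :&: lo != set0).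
  rewrite inE => /andP[uZ ulo]; apply: acyclic_no_card => A /andP[_ /and3P[/subsetP/(_ u ulo)]].
  by rewrite inE uZ.
rewrite negbK setI_eq0 => dZlo.
have [/existsP[v /and3P[vhi vlo vZ]]|] := boolP [exists v, [&& v \in hi, v \notin lo & v \notin Z]].
  apply: (acyclic_toggle rk_inj (v := v)) => A vA; rewrite /translate.
  have -> : (v |: A) :\: Z = v |: (A :\: Z).
    by apply/setP => u; rewrite !inE; case: (u =P v) => [->|//]; rewrite vZ.
  set B := A :\: Z; have -> : (Z \subset v |: A) = (Z \subset A).
    apply/subsetP/subsetP => sub u uZ; have := sub u uZ; rewrite in_setU1.
      by case: (u =P v) uZ => [->|//]; rewrite (negPf vZ).
    by move=> ->; rewrite orbT.
  congr (_ && _); rewrite /box; congr [&& _, _ & F' _].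
  - apply/subsetP/subsetP => sub u uZ; have := sub u uZ; rewrite in_setU1.
      by case: (u =P v) uZ => [->|//]; rewrite (negPf vlo).
    by move=> ->; rewrite orbT.
  - by rewrite subUset sub1set inE vhi.
  apply/setP => h; rewrite !in_trace in_setU1; case: eqP => // e.
  case: (boolP (h \in S)) => // hS; have := hi_notin_core vhi.
  by rewrite -e imset_f.
rewrite negb_exists => /forallP hiZ.
have hi_lo u : u \in hi -> u \notin lo -> u \in Z.
  by move=> uhi ulo; have := hiZ u; rewrite uhi ulo /= negbK.
pose W := (Z :\: iota @: S) :|: lo; pose Z' := trace Z.
have loZ u : u \in lo -> u \notin Z by move=> ulo; rewrite (disjointFl dZlo).
have loS h : h \in S -> iota h \notin lo.
  by move=> hS; apply: contraL (imset_f iota hS) => /(subsetP lo_hi); apply: hi_notin_core.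
have WS h : h \in S -> iota h \notin W.
  by move=> hS; rewrite !inE imset_f //= loS.
have FS D : translate F' Z' D -> D \subset S.
  move=> /andP[Z'D /F'S DS]; apply/subsetP => h hD.
  have [|hZ] := boolP (h \in Z'); first by rewrite in_trace => /andP[].
  by apply: (subsetP DS); rewrite inE hZ.
have disjW D : translate F' Z' D -> [disjoint W & iota @: D].
  move=> /FS DS; rewrite disjoint_sym disjoint_subset; apply/subsetP => u /imsetP[h hD ->].
  by rewrite inE WS // (subsetP DS).
have toBox D : translate F' Z' D -> translate box Z (W :|: iota @: D).
  move=> FD; have DS := FS D FD; have /andP[Z'D F'D] := FD; apply/andP; split.
    apply/subsetP => u uZ; rewrite !inE uZ andbT; case: imsetP => //= -[h hS ue].
    by rewrite ue imset_f ?orbT // (subsetP Z'D) // in_trace hS -ue.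
  apply/and3P; split.
  - by apply/subsetP => u ulo; rewrite !inE ulo loZ // orbT.
  - apply/subsetP => u; rewrite !inE => /andP[uZ]; rewrite (negPf uZ) andbF /=.
    case/orP => [/(subsetP lo_hi) -> //|/imsetP[h hD ->]].
    by rewrite imset_f ?orbT // (subsetP DS).
  rewrite (_ : trace _ = D :\: Z') //; apply/setP => h.
  rewrite in_trace [iota h \in _]in_setD in_setU [RHS]in_setD.
  have [hS|hS] /= := boolP (h \in S); last first.
    by apply/esym/negbTE; apply: contra hS => /andP[_]; apply: (subsetP DS).
  by rewrite (negPf (WS h hS)) mem_imset // [h \in Z']in_trace hS.
have fromBox A : translate box Z A -> exists2 D, translate F' Z' D & A = W :|: iota @: D.
  move=> /andP[ZA /and3P[loA Ahi F'A]]; exists (trace A).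
    apply/andP; split.
      by apply/subsetP => h; rewrite !in_trace => /andP[-> /(subsetP ZA) ->].
    rewrite (_ : _ :\: _ = trace (A :\: Z)) //; apply/setP => h.
    by rewrite !inE; case: (h \in S) => //=.
  apply/setP => u; rewrite !inE; apply/idP/idP => [uA|].
    have [uS|uS] := boolP (u \in iota @: S).
      by case/imsetP: uS uA => h hS -> uA; rewrite [_ \in iota @: trace A]imset_f ?orbT // in_trace hS.
    have [uZ|uZ] := boolP (u \in Z) => //=.
    have := subsetP Ahi u; rewrite !inE uZ uA (negPf uS) orbF => /(_ isT) uhi.
    by rewrite (contraNT (hi_lo u uhi)).
  case/orP => [/orP[/andP[_ /(subsetP ZA)]//|/(subsetP loA)]|/imsetP[h]].
    by rewrite inE => /andP[].
  by rewrite in_trace => /andP[_ hA] ->.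
have hiW : (#|hi| <= #|W|)%N.
  apply: subset_leq_card; apply/subsetP => u uhi; rewrite !inE hi_notin_core //=.
  by case: (boolP (u \in lo)) => [|/(hi_lo u uhi) ->]; rewrite ?orbT.
have [iW|Wi] := ltnP i #|W|.
  apply: acyclic_no_card => A /fromBox[D FD ->] e; move: iW.
  by rewrite -e (card_shift iota_inj disjW FD) ltnNge leq_addr.
rewrite -(subnKC Wi); apply: (acyclic_shift iota_inj toBox fromBox disjW).
apply: hF; first exact: inj_comp.
by rewrite ltn_subLR //; apply: leq_trans ilt _; rewrite addnC leq_add2r.
Qed.

(** When [lo = hi], the box is a shift of [F'] by [lo].  The translate of [F'] by
    a set [Z'] comes from that of the box by the image of [Z' :&: S]; the part of
    [Z'] outside [S] is taken out of the shift, which is possible because [lo]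
    contains its image. *)
Lemma box_hochster d : lo = hi -> iota @: (~: S) \subset lo ->
  hochster K box d -> hochster K F' (d - #|lo|).
Proof.
move=> elo loC hB rk' Z' j rk'_inj jlt.
(* [rk] extends the order [rk'] along [iota], the other vertices being last. *)
pose M := (\max_h rk' h).+1.
pose rk u := if [pick h | iota h == u] is Some h then rk' h else (M + enum_rank u)%N.
have rkE : rk \o iota = rk'.
  apply/funext => h; rewrite /rk /=; case: pickP => [h' /eqP/iota_inj -> //|/(_ h)].
  by rewrite eqxx.
have rk'M h : (rk' h < M)%N by rewrite ltnS; apply: leq_bigmax.
have rk_inj : injective rk.
  move=> u v; rewrite /rk; case: pickP => [h /eqP <-|_]; case: pickP => [h' /eqP <-|_].
  - by move/rk'_inj ->.
  - by move=> e; have := rk'M h; rewrite e ltnNge leq_addr.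
  - by move=> e; have := rk'M h'; rewrite -e ltnNge leq_addr.
  - by move/addnI/val_inj/enum_rank_inj.
have loS h : h \in S -> iota h \notin lo.
  by move=> hS; apply: contraL (imset_f iota hS); rewrite elo; apply: hi_notin_core.
pose Z := iota @: (Z' :&: S); pose W := lo :\: iota @: (Z' :\: S).
have ZE h : (iota h \in Z) = (h \in Z') && (h \in S) by rewrite mem_imset // inE.
have WE h : (iota h \in W) = (h \notin S) && (h \notin Z').
  rewrite inE mem_imset // inE; have [hS|hS] /= := boolP (h \in S).
    by rewrite (negPf (loS h hS)).
  by rewrite (subsetP loC) ?andbT // imset_f // inE.
have disjW D : translate F' Z' D -> [disjoint W & iota @: D].
  move=> /andP[_ /F'S/subsetP DS]; rewrite disjoint_sym disjoint_subset.
  apply/subsetP => u /imsetP[h hD ->]; rewrite inE WE negb_and !negbK.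
  by have [|hZ] := boolP (h \in Z'); rewrite ?orbT // DS // inE hZ.
have toBox D : translate F' Z' D -> translate box Z (W :|: iota @: D).
  move=> FD; have /andP[/subsetP Z'D F'D] := FD; have /subsetP DS := F'S F'D.
  apply/andP; split.
    apply/subsetP => u /imsetP[h]; rewrite inE => /andP[hZ _] ->.
    by rewrite inE imset_f ?orbT ?Z'D.
  apply/and3P; split.
  - apply/subsetP => u ulo; rewrite !inE ulo andbT; apply/andP; split.
      apply/imsetP => -[h]; rewrite inE => /andP[_ hS] uE.
      by move: (loS h hS); rewrite -uE ulo.
    have [|//] := boolP (u \in iota @: (Z' :\: S)) => /imsetP[h].
    by rewrite inE => /andP[_ /Z'D hD] ->; rewrite imset_f.
  - apply/subsetP => u; rewrite !inE -elo => /andP[uZ /orP[/andP[_ ->] //|]].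
    move=> /imsetP[h hD uE]; move: uZ; rewrite uE ZE negb_and.
    have [hS _|hS] := boolP (h \in S); first by rewrite imset_f ?orbT.
    by rewrite (subsetP loC) // imset_f // inE.
  rewrite (_ : trace _ = D :\: Z') //; apply/setP => h.
  rewrite in_trace [_ \in _ :\: Z]inE ZE in_setU WE mem_imset // !inE.
  have [hS|hS] /= := boolP (h \in S); first by rewrite andbT.
  by apply/esym/negbTE; apply: contra hS => hD; apply: DS; rewrite inE.
have fromBox A : translate box Z A -> exists2 D, translate F' Z' D & A = W :|: iota @: D.
  move=> /andP[/subsetP ZA /and3P[/subsetP loA /subsetP Ahi F'A]].
  exists (Z' :|: trace (A :\: Z)).
    rewrite /translate subsetUl (_ : _ :\: _ = trace (A :\: Z)) //; apply/setP => h.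
    rewrite in_setD in_setU !in_trace in_setD ZE.
    by case: (h \in S); rewrite ?andbF ?andbT ?orbF //=; case: (h \in Z').
  apply/setP => u; rewrite in_setU; apply/idP/idP => [uA|].
    have [uZ|uZ] := boolP (u \in Z).
      by case/imsetP: uZ => h; rewrite inE => /andP[hZ _] ->; rewrite imset_f ?orbT ?inE ?hZ.
    have := Ahi u; rewrite !inE uZ uA -elo => /(_ isT)/orP[ulo|/imsetP[h hS uE]].
      rewrite ulo andbT; have [|//] := boolP (u \in iota @: (Z' :\: S)) => /imsetP[h].
      by rewrite inE => /andP[_ hZ'] ->; rewrite imset_f // inE hZ'.
    by rewrite orbC uE imset_f // in_setU in_trace in_setD -uE uZ uA hS orbT.
  case/orP => [|/imsetP[h]].
    by rewrite inE => /andP[_ /loA]; rewrite inE => /andP[].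
  rewrite in_setU in_trace in_setD => /orP[hZ'|/and3P[_ _ hA]] -> //.
  have [hS|hS] := boolP (h \in S); first by apply: ZA; rewrite ZE hZ'.
  suff /loA : iota h \in lo by rewrite inE => /andP[].
  by rewrite (subsetP loC) // imset_f // inE.
rewrite -rkE; apply: (acyclic_unshift iota_inj toBox fromBox disjW).
apply: hB => //; rewrite ltn_subRL in jlt; apply: leq_ltn_trans jlt.
by rewrite leq_add2r; apply: subset_leq_card; apply: subsetDl.
Qed.
End Box.

(** Restricting to the members that contain a fixed set [B]: the topological
    link.  Each element of [B] costs one connecting homomorphism. *)
Lemma hochster_link (K : fieldType) (V : finType) (F : pred {set V}) d (B : {set V}) :
    (forall A C : {set V}, C \subset A -> F A -> F C) -> hochster K F d ->
  hochster K (fun A => (B \subset A) && F A) d.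
Proof.
move=> F_down hF rk Z i rk_inj.
move: {2}_.+1 (ltnSn #|B|) => N; elim: N B Z i => // N IHN B Z i; rewrite ltnS => cB ilt.
have [->|[v vB]] := set_0Vmem B.
  by apply: eq_acyclic (hF rk Z i rk_inj ilt) => A; rewrite /translate sub0set.
pose B' := B :\ v; have BE : B = v |: B' by rewrite setD1K.
have cB' : (#|B'| < N)%N by move: cB; rewrite (cardsD1 v) vB.
pose F0 := translate (fun A => (B' \subset A) && F A) Z.
have eqB A : translate (fun A => (B \subset A) && F A) Z A = F0 A && (v \in A :\: Z).
  by rewrite /translate BE subUset sub1set -!andbA; do !bool_congr; rewrite andbC -andbA.
apply: (eq_acyclic (fun A => esym (eqB A))).
case: i ilt => [|i] ilt.
  apply: acyclic_no_card => A /andP[_]; rewrite inE => /andP[_ vA] /cards0_eq A0.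
  by rewrite A0 inE in vA.
have [vZ|vZ] := boolP (v \in Z).
  by apply: acyclic_no_card => A /andP[_]; rewrite inE vZ.
have F0_convex : convex_family F0.
  move=> A C E /and3P[ZA BA _] /and3P[_ _ FE] sAC CE; apply/and3P; split.
  - exact: subset_trans sAC.
  - exact: subset_trans BA (setSD _ sAC).
  - exact: F_down (setSD _ CE) FE.
apply: (acyclic_upper rk_inj F0_convex).
- by move=> A C _ _ sAC; apply: (subsetP (setSD _ sAC)).
- exact: IHN.
have F'F D : F0 D && (v \notin D :\: Z) ->
    translate (fun A => (B' \subset A) && F A) (v |: Z) ([set v] :|: (fun x => x) @: D).
  rewrite imset_id inE negb_and vZ /= => /andP[/andP[ZD FD] vD].
  rewrite /translate setUS // (_ : _ :\: _ = D :\: Z) //; apply/setP => u; rewrite !inE.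
  by case: (u =P v) => [->|//]; rewrite (negPf vD) andbF.
have FF' A : translate (fun A => (B' \subset A) && F A) (v |: Z) A ->
    exists2 D, F0 D && (v \notin D :\: Z) & A = [set v] :|: (fun x => x) @: D.
  rewrite /translate subUset sub1set => /andP[/andP[vA ZA] FA].
  have e : A :\ v :\: Z = A :\: (v |: Z) by rewrite setDDl.
  exists (A :\ v); last by rewrite imset_id setD1K.
  by rewrite /F0 /translate e FA subsetD1 ZA vZ !inE eqxx /=.
have disj D : F0 D && (v \notin D :\: Z) -> [disjoint [set v] & (fun x => x) @: D].
  by rewrite imset_id disjoints1 inE vZ => /andP[].
have := @acyclic_unshift K V V rk (fun x => x) (@inj_id V) [set v] _ _ F'F FF' disj i.
by rewrite cards1; apply; apply: IHN.
Qed.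

(** * Faces of the corona of a star *)

Lemma face_nonisolated (H : sgraph) (D : {set H}) :
  face D -> D \subset ~: isolated H.
Proof. by move=> /faceP fD; apply/subsetP => h /fD[]; rewrite in_setC. Qed.

Section Corona.
Variables (n : nat) (H : sgraph).
Hypothesis n_gt0 : (0 < n)%N.
Local Notation I := 'I_n.+1.
Local Notation G := (corona (star n) H).

Definition base_vertex : H := enum_val (Ordinal (vertex_gt0 H)).
Local Notation h0 := base_vertex.

Definition star_vertex (i : I) : G := inl i.
Definition copy (k : I) (h : H) : G := inr (k, h).

Lemma copy_inj k : injective (copy k). Proof. by move=> h h' []. Qed.

Definition star_part (A : {set G}) : {set I} := [set i | star_vertex i \in A].

(** A copy of [H] whose vertex on the star is not in [T], for [T] the star
    part of a face. *)
Definition kept (T : {set I}) : I := if ord0 \in T then ord_max else ord0.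

(** The part of [A] in the copies other than the kept one, where a copy that
    [A] meets at most in [h0] is ignored. *)
Definition rest (A : {set G}) : {set I * H} :=
  [set p | [&& inr p \in A, p.1 != kept (star_part A) &
            [exists h, (h != h0) && (copy p.1 h \in A)]]].

Definition piece_lo (T : {set I}) (L : {set I * H}) : {set G} :=
  [set u | match u with inl i => i \in T | inr p => p \in L end].

(** The vertex [h0] is free in the copies that are neither excluded by [T] nor
    met by [L]. *)
Definition piece_hi (T : {set I}) (L : {set I * H}) : {set G} :=
  [set u | match u with
    | inl i => i \in T
    | inr (j, h) => if j == kept T then h \in isolated H else
        ((j, h) \in L) || [&& h == h0, j \notin T & [forall h', (j, h') \notin L]]
    end].

Definition piece T L : pred {set G} :=
  box (copy (kept T)) (@face H) (~: isolated H) (piece_lo T L) (piece_hi T L).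

Lemma edge_star_copy i h : edge (star_vertex i) (copy i h).
Proof. by rewrite /edge /= eqxx. Qed.

Lemma edge_copy_star i h : edge (copy i h) (star_vertex i).
Proof. by rewrite /edge /= eqxx. Qed.

Lemma edge_copy k h h' : edge (copy k h) (copy k h') = edge h h'.
Proof. by rewrite {1}/edge /= eqxx. Qed.

Lemma isolated_corona : isolated G = set0.
Proof.
apply/setP => u; rewrite !inE; apply/negbTE; rewrite negb_forall; apply/existsP.
case: u => [i|[i h]]; first by exists (copy i h0); rewrite negbK edge_star_copy.
by exists (star_vertex i); rewrite negbK edge_copy_star.
Qed.

Lemma face_coronaP (A : {set G}) :
  reflect (forall x y, x \in A -> y \in A -> ~~ edge x y) (face A).
Proof.
apply: (iffP (faceP A)) => [fA x y xA|fA x xA].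
  by have [_] := fA x xA; apply.
by split=> [|y]; [rewrite isolated_corona inE|apply: fA].
Qed.

Lemma face_trace k (A : {set G}) :
  face A -> face (trace (copy k) (~: isolated H) A).
Proof.
move=> /face_coronaP fA; apply/faceP => h; rewrite in_trace inE => /andP[hi hA].
by split=> // h'; rewrite in_trace => /andP[_ /(fA _ _ hA)]; rewrite edge_copy.
Qed.

Lemma kept_notin (A : {set G}) : face A -> kept (star_part A) \notin star_part A.
Proof.
move=> /face_coronaP fA; rewrite /kept; case: ifPn => // z; rewrite inE in z.
rewrite inE; apply/negP => m; move/negP: (fA _ _ z m); apply; apply/andP; split=> //.
by rewrite -val_eqE /= eq_sym -lt0n.
Qed.

Lemma piece_lo_hi (A : {set G}) : face A ->
  piece_lo (star_part A) (rest A) \subset piece_hi (star_part A) (rest A).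
Proof.
move=> fA; apply/subsetP => -[i|[j h]]; rewrite !inE // => /and3P[hA /= nk ex].
by rewrite (negPf nk) hA ex.
Qed.

Lemma piece_hi_core T L :
  [disjoint piece_hi T L & copy (kept T) @: (~: isolated H)].
Proof.
rewrite disjoint_sym disjoint_subset; apply/subsetP => u /imsetP[h hi ->].
by rewrite in_setC in hi; rewrite inE in_set /= eqxx.
Qed.

Lemma core_copyE k (S : {set H}) j h :
  (inr (j, h) \in copy k @: S) = (j == k) && (h \in S).
Proof.
apply/imsetP/andP => [[h' h'S [-> ->]]|[/eqP-> hS]]; first by rewrite eqxx.
by exists h.
Qed.

Lemma core_starE k (S : {set H}) i : (inl i \in copy k @: S) = false.
Proof. by apply/imsetP => -[h]. Qed.

(** The faces with prescribed star part and rest form a box over [face H].  The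
    hypothesis that some face realizes [T] and [L] ensures that [T] and [L] are
    independent and compatible. *)
Lemma pieceP (A0 A : {set G}) (T := star_part A0) (L := rest A0) : face A0 ->
  piece T L A = [&& face A, star_part A == T & rest A == L].
Proof.
move=> fA0; have kT : kept T \notin T := kept_notin fA0.
have /face_coronaP f0 := fA0.
have LA0 p : p \in L -> inr p \in A0 by rewrite inE => /and3P[].
have Lk p : p \in L -> p.1 != kept T by rewrite inE => /and3P[].
have TA0 i : i \in T -> inl i \in A0 by rewrite inE.
apply/and3P/and3P => [[/subsetP loA /subsetP Ahi fC]|[fA /eqP eT /eqP eL]]; last first.
  have /face_coronaP fA' := fA.
  split; last exact: face_trace.
    apply/subsetP => -[i|p]; rewrite inE.
      by rewrite -eT inE.
    by rewrite -eL inE => /and3P[].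
  apply/subsetP => -[i|[j h]] uA; rewrite in_setU.
    by rewrite inE -eT inE uA.
  rewrite core_copyE inE; case: ifPn => [_|jk] /=.
    by rewrite in_setC orbN.
  rewrite orbF; have [//|jhL] /= := boolP ((j, h) \in L).
  have noex h' : copy j h' \in A -> h' = h0.
    move=> h'A; apply/eqP; apply: contraNT jhL => ne.
    by rewrite -eL inE uA /= eT jk; apply/existsP; exists h'; rewrite ne.
  rewrite (noex h uA) eqxx /=; apply/andP; split.
    rewrite -eT inE; apply/negP => jA.
    by have := fA' _ _ jA uA; rewrite edge_star_copy.
  apply/forallP => h'; apply/negP; rewrite -eL inE => /and3P[_ _ /existsP[h2]].
  by move=> /andP[ne /noex e]; rewrite e eqxx in ne.
have inA u : u \in A -> u \in piece_hi T L :|: copy (kept T) @: ~: isolated H.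
  exact: Ahi.
have eT : star_part A = T.
  apply/setP => i; rewrite inE; apply/idP/idP => [/inA|iT].
    by rewrite in_setU core_starE orbF inE.
  by apply: loA; rewrite inE.
have inAj j h : j != kept T -> copy j h \in A ->
    (j, h) \in L \/ [/\ h = h0, j \notin T & forall h', (j, h') \notin L].
  move=> jk /inA; rewrite in_setU [X in _ || X]core_copyE in_set /= (negPf jk) /= orbF.
  by case/orP => [|/and3P[/eqP ? ? /forallP]]; [left|right].
have inAk h : copy (kept T) h \in A -> h \notin isolated H ->
    h \in trace (copy (kept T)) (~: isolated H) A.
  by move=> hA hi; rewrite in_trace inE hi.
have eL : rest A = L.
  apply/setP => -[j h]; rewrite inE eT /=; apply/and3P/idP => [[jhA jk]|jhL].
    case/existsP => h' /andP[ne]; case/(inAj _ _ jk) => [h'L|[e]]; last first.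
      by rewrite e eqxx in ne.
    by case: (inAj _ _ jk jhA) => // -[_ _ /(_ h')]; rewrite h'L.
  split; [by apply: loA; rewrite inE|exact: (Lk (j, h))|].
  have := jhL; rewrite inE => /and3P[_ jk /existsP[h' /andP[ne h'A]]].
  apply/existsP; exists h'; rewrite ne; apply: loA; rewrite in_set /= inE h'A jk.
  by apply/existsP; exists h'; rewrite ne.
split; [apply/face_coronaP|exact/eqP|exact/eqP].
have starA i : inl i \in A -> i \in T by rewrite -eT inE.
have noSC i h : inl i \in A -> inr (i, h) \in A -> False.
  move=> iA ihA; have iT := starA i iA.
  have ik : i != kept T by apply: contraNneq kT => <-.
  case: (inAj _ _ ik ihA) => [ihL|[_]]; last by rewrite iT.
  by have := f0 _ _ (TA0 i iT) (LA0 _ ihL); rewrite edge_star_copy.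
move=> [i|[j h]] [i'|[j' h']] uA vA.
- by apply: f0; apply/TA0/starA.
- by apply/negP; rewrite /edge /= => /eqP e; subst; apply: noSC uA vA.
- by apply/negP; rewrite /edge /= => /eqP e; subst; apply: noSC vA uA.
apply/negP; rewrite {1}/edge /= => /andP[/eqP e]; subst j' => hh'.
have [jk|jk] := eqVneq j (kept T).
  rewrite jk in uA vA; move/faceP: fC => fC.
  have ni x y : edge x y -> x \notin isolated H.
    by move=> xy; rewrite inE negb_forall; apply/existsP; exists y; rewrite negbK.
  have h'h : edge h' h by rewrite edge_sym.
  have [_ /(_ h' (inAk _ vA (ni _ _ h'h)))] := fC h (inAk _ uA (ni _ _ hh')).
  by rewrite hh'.
case: (inAj _ _ jk uA) (inAj _ _ jk vA) => [hL|[eh _ noL]] [h'L|[eh' _ noL']].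
- by have := f0 _ _ (LA0 _ hL) (LA0 _ h'L); rewrite edge_copy hh'.
- by have := noL' h; rewrite hL.
- by have := noL h'; rewrite h'L.
- by move: hh'; rewrite eh eh' edge_irr.
Qed.

(** Each copy other than the kept one contributes the vertex [phi j] to [hi]. *)
Lemma card_piece_hi (A : {set G}) : face A ->
  (n + #|isolated H| <= #|piece_hi (star_part A) (rest A)|)%N.
Proof.
move=> fA; set T := star_part A; set L := rest A.
pose k := kept T.
pose phi (j : I) : G := if j \in T then inl j else
  if [pick h | (j, h) \in L] is Some h then inr (j, h) else inr (j, h0).
pose idx (u : G) : I := match u with inl i => i | inr p => p.1 end.
have idx_phi j : idx (phi j) = j by rewrite /phi; case: ifP => // _; case: pickP.
have phi_inj : injective phi by apply: (can_inj idx_phi).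
pose B := phi @: [set~ k] :|: copy k @: isolated H.
have cB : #|B| = (n + #|isolated H|)%N.
  rewrite cardsU card_imset // card_imset; last exact: copy_inj.
  rewrite cardsC1 card_ord (_ : _ :&: _ = set0) ?cards0 ?subn0 //.
  apply/setP => u; rewrite !inE; apply/negP => /andP[/imsetP[j]].
  rewrite !inE => jk -> /imsetP[h _ e]; move: (idx_phi j); rewrite e /= => kj.
  by rewrite kj eqxx in jk.
rewrite -cB; apply: subset_leq_card; apply/subsetP => u; rewrite in_setU.
case/orP => /imsetP[x]; last by move=> xi ->; rewrite in_set /= eqxx.
rewrite in_setC1 => xk ->; rewrite in_set /phi; case: ifP => //= xT.
case: pickP => [h hL|noL]; rewrite (negPf xk) ?hL // eqxx xT /=.
by rewrite orbC; apply/orP; left; apply/forallP => h'; rewrite noL.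
Qed.

(** The leaves and the isolated vertices of the copy at the centre. *)
Definition leaf_face : {set G} := piece_hi [set~ ord0] set0.

(** The leaves exclude the centre and their copies of [H]. *)
Lemma leaf_star (A : {set G}) : face A -> leaf_face \subset A ->
  star_part A = [set~ ord0] /\ rest A = set0.
Proof.
move=> /face_coronaP fA /subsetP FA.
have leafA i : i != ord0 -> star_vertex i \in A.
  by move=> i0; apply: FA; rewrite /leaf_face in_set /= in_setC1.
have m0 : ord_max != ord0 :> I by rewrite -val_eqE /= -lt0n.
have eT : star_part A = [set~ ord0].
  apply/setP => i; rewrite !inE; apply/idP/idP => [iA|/leafA //].
  apply/negP => /eqP i0; rewrite i0 in iA.
  move/negP: (fA _ _ iA (leafA _ m0)); apply; apply/andP; split=> //.
  by rewrite eq_sym.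
split=> //; apply/setP => -[j h]; rewrite !inE eT /kept !inE eqxx /=.
apply/negP => /and3P[jhA /leafA jA _].
by have := fA _ _ jA jhA; rewrite edge_star_copy.
Qed.

Lemma kept_leaf : kept [set~ ord0] = ord0.
Proof. by rewrite /kept !inE eqxx. Qed.

Lemma leaf_faceE : leaf_face = piece_lo [set~ ord0] set0 :|: copy ord0 @: isolated H.
Proof.
apply/setP => -[i|[j h]]; rewrite in_setU ?core_starE ?core_copyE !inE ?orbF //.
rewrite kept_leaf; case: ifPn => // j0; rewrite j0 /=.
by rewrite andbF.
Qed.

Lemma face_leaf_face : face leaf_face.
Proof.
apply/face_coronaP => -[i|[j h]] [i'|[j' h']]; rewrite !inE ?kept_leaf.
- move=> i0 i'0; apply/negP => /andP[_]; by rewrite (negPf i0) (negPf i'0).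
- move=> i0; case: ifP => [/eqP -> _|j'0]; last by rewrite j'0 /= andbF.
  by apply/negP => /eqP e; rewrite e eqxx in i0.
- case: ifP => [/eqP -> _|j'0]; last by rewrite j'0 /= andbF.
  by move=> i0; apply/negP => /eqP e; rewrite -e eqxx in i0.
case: ifP => [/eqP -> /forallP hi|j0]; last by rewrite j0 /= andbF.
by move=> _; apply/negP => /andP[_]; apply/negP.
Qed.

Lemma card_leaf_face : #|leaf_face| = (n + #|isolated H|)%N.
Proof.
rewrite leaf_faceE cardsU (card_imset _ (@copy_inj ord0)).
rewrite (_ : piece_lo _ _ = star_vertex @: [set~ ord0]); last first.
  apply/setP => -[i|p]; rewrite !inE.
    by rewrite (mem_imset _ _ (fun i j (e : inl i = inl j :> G) => let: erefl := e in erefl)) !inE.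
  by apply/esym/imsetP => -[].
rewrite card_imset; last by move=> i j [].
rewrite cardsC1 card_ord (_ : _ :&: _ = set0) ?cards0 ?subn0 //.
by apply/setP => u; rewrite !inE; apply/negP => /andP[/imsetP[i _ ->] /imsetP[]].
Qed.

(** The faces that contain [leaf_face] form a link isomorphic to [face H]. *)
Lemma face_leaf (A : {set G}) : (leaf_face \subset A) && face A =
  box (copy ord0) (@face H) (~: isolated H) leaf_face leaf_face A.
Proof.
have [eT eL] := leaf_star face_leaf_face (subxx _).
have pE := pieceP A face_leaf_face; rewrite eT eL in pE.
have lo_leaf : piece_lo [set~ ord0] set0 \subset leaf_face.
  by rewrite leaf_faceE subsetUl.
have -> : (leaf_face \subset A) && face A =
    (leaf_face \subset A) && piece [set~ ord0] set0 A.
  rewrite pE; have [FA|//] := boolP (leaf_face \subset A).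
  by have [fA|//] := boolP (face A); have [-> ->] := leaf_star fA FA; rewrite !eqxx.
rewrite /piece /box kept_leaf; have [FA|//] := boolP (leaf_face \subset A).
by rewrite (subset_trans lo_leaf FA).
Qed.

End Corona.

Section CoronaDepth.
Variables (K : fieldType) (n : nat) (H : sgraph).
Hypothesis n_gt0 : (0 < n)%N.
Local Notation G := (corona (star n) H).

(** The filtration by the star part, refined by the rest.  The second label is
    monotone only for a fixed star part, since the latter determines which copy
    is kept. *)
Lemma hochster_corona t : hochster K (@face H) t ->
  hochster K (@face G) (t + (n + #|isolated H|)).
Proof.
move=> hH rk Z i rk_inj ilt.
have tr_convex : convex_family (translate (@face G) Z).
  move=> A B C /andP[ZA _] /andP[_ fC] AB BC; apply/andP; split.
    exact: subset_trans AB.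
  exact: face_sub (setSD _ BC) fC.
have star_mono (A C : {set G}) : A \subset C ->
    star_part (A :\: Z) \subset star_part (C :\: Z).
  move=> /subsetP sAC; apply/subsetP => j; rewrite !inE => /andP[->].
  exact: sAC.
apply: (acyclic_fibers rk_inj (lab := fun A => star_part (A :\: Z))) => //.
  by move=> A C _ _; apply: star_mono.
move=> T; apply: (acyclic_fibers rk_inj (lab := fun A => rest (A :\: Z))).
- move=> A B C /andP[FA /eqP TA] /andP[FC /eqP TC] AB BC.
  rewrite (tr_convex _ _ _ FA FC AB BC) eqEsubset -{1}TC -TA !star_mono //.
- move=> A C /andP[_ /eqP TA] /andP[_ /eqP TC] /subsetP sAC.
  apply/subsetP => p; rewrite inE TA => /and3P[pA pk /existsP[h /andP[ne hA]]].
  have sub u : u \in A :\: Z -> u \in C :\: Z by rewrite !inE => /andP[-> /sAC].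
  rewrite inE TC pk sub //; apply/existsP; exists h; by rewrite ne sub.
move=> L.
have [[A0 /and3P[/andP[ZA0 fA0] /eqP TA0 /eqP LA0]]|none] :=
    pselect (exists A0, [&& translate (@face G) Z A0, star_part (A0 :\: Z) == T
      & rest (A0 :\: Z) == L]); last first.
  by apply: acyclic_no_card => A HA _; apply: none; exists A; rewrite andbA.
have hbox : hochster K (piece T L) (t + #|piece_hi T L|).
  apply: (hochster_box (@copy_inj n H (kept T))) => //.
  - exact: face_nonisolated.
  - by rewrite -TA0 -LA0; apply: piece_lo_hi.
  - exact: piece_hi_core.
apply: (eq_acyclic (F := translate (piece T L) Z)).
  by move=> A; rewrite /translate -TA0 -LA0 pieceP // TA0 LA0 -!andbA.
apply: hbox => //; apply: leq_trans ilt _; rewrite leq_add2l -TA0 -LA0.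
exact: card_piece_hi.
Qed.

(** The link of [leaf_face] is [face H]. *)
Lemma corona_hochster d : hochster K (@face G) d ->
  hochster K (@face H) (d - (n + #|isolated H|)).
Proof.
move=> hG; rewrite -(card_leaf_face n H).
have hL := hochster_link (B := leaf_face n H) (@face_sub G) hG.
apply: (box_hochster (@copy_inj n H ord0) (S := ~: isolated H) (hi := leaf_face n H)) => //.
- exact: face_nonisolated.
- by have := @piece_hi_core n H [set~ ord0] set0; rewrite kept_leaf.
- by rewrite setCK leaf_faceE subsetUr.
move=> rk Z i rk_inj ilt; apply: eq_acyclic (hL rk Z i rk_inj ilt) => A.
by rewrite /translate face_leaf.
Qed.

Lemma corona_depth :
  edge_depth K G = (n + edge_depth K H + #|isolated H|)%N.
Proof.
have [hH maxH] := edge_depth_is_max K H.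
have [hG maxG] := edge_depth_is_max K G.
apply/anti_leq/andP; split.
  by have := maxH _ (corona_hochster hG); lia.
by have := maxG _ (hochster_corona hH); lia.
Qed.
End CoronaDepth.

(** * Stanley decompositions as partitions of monomials *)

Section StanleyCells.
Variables (K : fieldType) (G : sgraph).
Local Notation R := {mpoly K[#|G|]}.
Local Notation I := (@edge_ideal K G).
Local Notation M := (edge_ring K G).
Local Notation mon := 'X_{1..#|G|}.
Implicit Types (u v w : mon) (X : {set 'I_#|G|}).

Definition standard w := face (msupport w).

(** The monomials of the Stanley space of [u] and [X]. *)
Definition in_cell u X w := (u <= w)%MM && [forall (i | i \notin X), w i == u i].

Definition stanley_partition (J : finType) (u : J -> mon) (X : J -> {set 'I_#|G|}) :=
  (forall j w, in_cell (u j) (X j) w -> standard w) /\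
  (forall w, standard w -> exists2 j, in_cell (u j) (X j) w &
     forall j', in_cell (u j') (X j') w -> j' = j).

Lemma in_cellP u X w :
  reflect (exists2 v : mon, (forall i, i \notin X -> v i = 0%N) & w = (u + v)%MM) (in_cell u X w).
Proof.
apply: (iffP andP) => [[uw /forall_inP wX]|[v vX ->]].
  exists (w - u)%MM; last by rewrite addmC submK.
  by move=> i /wX/eqP wi; rewrite mnmBE wi subnn.
split; first by apply/mnm_lepP => i; rewrite mnmDE leq_addr.
by apply/forall_inP => i /vX vi; rewrite mnmDE vi addn0.
Qed.

Lemma standard_edge (f : R) w : f \in I -> standard w -> f@_w = 0.
Proof. by move=> /edge_idealP; apply. Qed.

Lemma monomial_edge w : ('X_[w] \in I) = ~~ standard w.
Proof.
apply/idP/idP => [wI|nw]; last first.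
  apply/edge_idealP => m fm; rewrite mcoeffX; case: eqP => // e.
  by rewrite e /standard fm in nw.
by apply/negP => /(standard_edge wI)/eqP; rewrite mcoeffX eqxx oner_eq0.
Qed.

Lemma mpoly_inX X v : (forall i, i \notin X -> v i = 0%N) -> mpoly_in X ('X_[v] : R).
Proof. by move=> vX m; rewrite msuppX inE => /eqP->. Qed.

Lemma mpoly_inB X (f g : R) : mpoly_in X f -> mpoly_in X g -> mpoly_in X (f - g).
Proof.
by move=> fX gX m /msuppB_le; rewrite mem_cat => /orP[/fX|/gX].
Qed.

Lemma mcoeffMX_neq0 X (f : R) u w : mpoly_in X f -> (f * 'X_[u])@_w != 0 -> in_cell u X w.
Proof.
move=> fX; rewrite -mcoeff_msupp (perm_mem (msuppMX f u)) => /mapP[m mf ->].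
by apply/in_cellP; exists m => //; apply: fX.
Qed.

Lemma scale_pi (f g : R) : f *: (\pi_{ideal_quot I} g : M) = \pi_{ideal_quot I} (f * g).
Proof. by transitivity (\pi_{ideal_quot I} f * \pi_{ideal_quot I} g); rewrite // -rmorphM. Qed.

Lemma pi_sum (J : finType) (g : J -> R) :
  \sum_j (\pi_{ideal_quot I} (g j) : M) = \pi_{ideal_quot I} (\sum_j g j).
Proof. by rewrite raddf_sum. Qed.

Lemma pi_edge_eq (f g : R) :
  (\pi_{ideal_quot I} f : M) = \pi_{ideal_quot I} g <-> f - g \in I.
Proof.
by split=> [/eqP|fI]; [|apply/eqP]; rewrite -Quotient.idealrBE.
Qed.

Section PartitionToDecomposition.
Variables (k : nat) (u : 'I_k -> mon) (X : 'I_k -> {set 'I_#|G|}).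
Hypothesis uX : stanley_partition u X.

(** The coefficient at a monomial of the [i]-th cell only involves [h i], by
    disjointness of the cells. *)
Lemma cells_independent (h : 'I_k -> R) : (forall j, mpoly_in (X j) (h j)) ->
  \sum_j h j * 'X_[u j] \in I -> forall i, h i = 0.
Proof.
have [std uniq] := uX; move=> hX hI i; apply/mpolyP => m; rewrite mcoeff0.
have [mh|/memN_msupp_eq0 //] := boolP (m \in msupp (h i)).
have cell_im : in_cell (u i) (X i) (u i + m)%MM.
  by apply/in_cellP; exists m => //; apply: hX mh.
have := standard_edge hI (std _ _ cell_im); rewrite raddf_sum (bigD1 i) //= mcoeffMX.
rewrite big1 ?addr0 // => j ji; apply/eqP; apply: contraNT ji => /mcoeffMX_neq0.
move=> /(_ _ (hX j)) cell_jm; have [l _ lP] := uniq _ (std _ _ cell_im).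
by rewrite (lP _ cell_im) (lP _ cell_jm).
Qed.

Lemma partition_decomposition : stanley_decomposition (M := M) (@quot_comp K #|G| I)
  (fun j => \pi_{ideal_quot I} 'X_[u j] : M) X.
Proof.
have [std uniq] := uX; split.
- move=> j; exists (fun i => (u j i)%:Z); exists 'X_[u j] => // m.
  by rewrite msuppX inE => /eqP->.
- move=> j f fX; rewrite scale_pi => /pi_edge_eq0 fI.
  have := @cells_independent (fun i => if i == j then f else 0) _ _ j.
  rewrite eqxx; apply=> [i|]; first by case: eqP => [->|_] //; move=> m; rewrite msupp0.
  rewrite (bigD1 j) //= eqxx big1 ?addr0 // => i /negPf->; by rewrite mul0r.
move=> x; have [f ->] := edge_ring_gen x; rewrite scale_edge_one.
pose p j : R := \sum_(w <- msupp f | in_cell (u j) (X j) w) f@_w *: 'X_[(w - u j)%MM].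
have pX j : mpoly_in (X j) (p j).
  move=> m /msupp_sum_le /flattenP[s /mapP[w]]; rewrite mem_filter => /andP[cw _] ->.
  move=> /msuppZ_le; rewrite msuppX inE => /eqP-> i iX; rewrite mnmBE.
  by move: cw => /andP[_ /forall_inP/(_ i iX)/eqP->]; rewrite subnn.
have pE j w : (p j * 'X_[u j])@_w = if in_cell (u j) (X j) w then f@_w else 0.
  rewrite /p mulr_suml raddf_sum /=.
  rewrite (eq_bigr (fun v => if v == w then f@_w else 0)) => [|v cv].
    case: ifP => cw; last first.
      by rewrite big1 // => v cv; case: eqP => // vw; rewrite vw cw in cv.
    have [wf|nwf] := boolP (w \in msupp f).
      rewrite big_mkcond (bigD1_seq w) ?msupp_uniq //= cw eqxx big1 ?addr0 // => v.
      by move=> /negPf ->; rewrite if_same.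
    rewrite (memN_msupp_eq0 nwf) big1 // => v _; by rewrite if_same.
  rewrite -scalerAl -mpolyXD submK; last by case/andP: cv.
  by rewrite mcoeffZ mcoeffX; case: eqP => [->|]; rewrite ?mulr1 ?mulr0.
have fp : f - \sum_j p j * 'X_[u j] \in I.
  apply/edge_idealP => w sw; have [j cj jP] := uniq w sw.
  rewrite mcoeffB raddf_sum (bigD1 j) //= pE cj big1 ?addr0 ?subrr // => i ij.
  by rewrite pE; case: ifP => // /jP e; rewrite e eqxx in ij.
exists [ffun j => p j *: (\pi_{ideal_quot I} 'X_[u j] : M)]; split.
  split; first by move=> j; rewrite ffunE; exists (p j).
  under eq_bigr do rewrite ffunE scale_pi.
  by rewrite pi_sum; apply/pi_edge_eq.
move=> b [bX bE]; apply/ffunP => j; rewrite ffunE.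
have /choice[g gP] : forall i, exists g, mpoly_in (X i) g /\
    b i = g *: (\pi_{ideal_quot I} 'X_[u i] : M).
  by move=> i; have [g gX bi] := bX i; exists g.
have fg : f - \sum_j g j * 'X_[u j] \in I.
  apply/pi_edge_eq; rewrite bE -pi_sum; apply: eq_bigr => i _.
  by have [_ ->] := gP i; rewrite scale_pi.
have /(_ j)/subr0_eq gE : forall i, g i - p i = 0.
  apply: cells_independent => [i|].
    by have [gX _] := gP i; apply: mpoly_inB.
  under eq_bigr do rewrite mulrBl.
  by rewrite sumrB; have := idealB (is_ideal_edge K G) fp fg; rewrite opprB addrC addrA subrK.
by have [_ ->] := gP j; rewrite gE.
Qed.
End PartitionToDecomposition.

(** Homogeneous elements of the edge ring are scalar multiples of monomials,
    so a Stanley decomposition partitions the standard monomials. *)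
Lemma decomposition_partition k (a : 'I_k -> M) (X : 'I_k -> {set 'I_#|G|}) :
  stanley_decomposition (@quot_comp K #|G| I) a X ->
  exists u : 'I_k -> mon, stanley_partition u X.
Proof.
move=> [ahom free dec].
have /choice[u uP] : forall i, exists u, exists2 c, c != 0 &
    a i = \pi_{ideal_quot I} (c *: 'X_[u]).
  move=> i; have [d [f fd aE]] := ahom i.
  have f0 : f != 0.
    apply/negP => /eqP f0; case/eqP: (oner_neq0 R); apply: (free i).
      by move=> m; rewrite msupp1 inE => /eqP-> j _; rewrite mnm0E.
    by rewrite scale1r aE f0 rmorph0.
  exists (mlead f), (mleadc f); first by rewrite mleadc_eq0.
  rewrite aE; congr (\pi_{ideal_quot I} _); apply/mpolyP => m.
  rewrite mcoeffZ mcoeffX; case: eqP => [->|ne]; first by rewrite mulr1.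
  rewrite mulr0; apply: memN_msupp_eq0; apply/negP => mf; apply: ne; apply/mnmP => j.
  by have := fd _ mf j; rewrite -(fd _ (mlead_supp f0) j) => -[].
have space i w : in_cell (u i) (X i) w ->
    stanley_space (a i) (X i) (\pi_{ideal_quot I} 'X_[w] : M).
  have [c c0 aE] := uP i; move=> /in_cellP[v vX ->].
  exists (c^-1 *: 'X_[v]); first by move=> m /msuppZ_le; apply: mpoly_inX vX m.
  rewrite aE scale_pi -scalerAl -scalerAr scalerA mulVf // scale1r -mpolyXD.
  by rewrite addmC.
have std i w : in_cell (u i) (X i) w -> standard w.
  have [c c0 aE] := uP i; move=> /in_cellP[v vX ->].
  apply: contraT; rewrite -monomial_edge => wI.
  have /eqP : 'X_[v] = 0 :> R.
    apply: (free i); first exact: mpoly_inX.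
    rewrite aE scale_pi -scalerAr -mpolyXD addmC -mul_mpolyC; apply/pi_edge_eq0.
    exact: (idealMl (is_ideal_edge K G)).
  by rewrite -msupp_eq0 msuppX.
exists u; split=> // w sw.
have [b [[bX bE] _]] := dec (\pi_{ideal_quot I} 'X_[w]).
have [j cj] : exists j, in_cell (u j) (X j) w.
  have /choice[g gP] : forall i, exists g, mpoly_in (X i) g /\ b i = g *: a i.
    by move=> i; have [g gX bi] := bX i; exists g.
  have /choice[c cP] : forall i, exists c, a i = \pi_{ideal_quot I} (c *: 'X_[u i]).
    by move=> i; have [c _ ->] := uP i; exists c.
  have : 'X_[w] - \sum_i c i *: (g i * 'X_[u i]) \in I.
    apply/pi_edge_eq; rewrite bE -pi_sum; apply: eq_bigr => i _.
    by have [_ ->] := gP i; rewrite cP scale_pi scalerAr.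
  move=> /standard_edge/(_ sw)/eqP; rewrite mcoeffB mcoeffX eqxx raddf_sum /=.
  apply: contraTP => none; rewrite big1 ?subr0 ?oner_eq0 // => i _.
  rewrite mcoeffZ; apply/eqP; rewrite mulf_eq0; apply/orP; right.
  apply: contraT => /mcoeffMX_neq0 ci; case: none; exists i; apply: ci.
  by have [] := gP i.
exists j => // j' cj'; apply: contrapT => /eqP jj'.
have single i : in_cell (u i) (X i) w ->
    (forall l, stanley_space (a l) (X l) ([ffun l => if l == i then \pi_{ideal_quot I} 'X_[w] else 0 : M] l))
    /\ \pi_{ideal_quot I} 'X_[w] = \sum_l [ffun l => if l == i then \pi_{ideal_quot I} 'X_[w] else 0 : M] l.
  move=> ci; split=> [l|].
    rewrite ffunE; case: eqP => [->|_]; first exact: space.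
    by exists 0; [move=> m; rewrite msupp0|rewrite scale0r].
  rewrite (bigD1 i) //= ffunE eqxx big1 ?addr0 // => l /negPf li.
  by rewrite ffunE li.
have [b' [_ b'U]] := dec (\pi_{ideal_quot I} 'X_[w]).
have /ffunP/(_ j) : [ffun l => if l == j then \pi_{ideal_quot I} 'X_[w] else 0 : M] =
    [ffun l => if l == j' then \pi_{ideal_quot I} 'X_[w] else 0 : M].
  by rewrite -(b'U _ (single j cj)) -(b'U _ (single j' cj')).
rewrite !ffunE eqxx eq_sym (negPf jj') => /pi_edge_eq0.
by rewrite monomial_edge sw.
Qed.
End StanleyCells.

(** * Stanley depth of edge rings *)

Lemma bigminn_geP (I : Type) (s : seq I) (F : I -> nat) r b :
  (b <= r)%N -> (forall i, b <= F i)%N -> (b <= \big[minn/r]_(i <- s) F i)%N.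
Proof.
by move=> br bF; elim/big_ind: _ => // x y bx byy; rewrite leq_min bx.
Qed.

Lemma bigminn_le (I : eqType) (s : seq I) (F : I -> nat) r i :
  i \in s -> (\big[minn/r]_(j <- s) F j <= F i)%N.
Proof.
elim: s => // j s IHs; rewrite inE big_cons => /predU1P[->|/IHs]; first exact: geq_minl.
by apply: leq_trans; apply: geq_minr.
Qed.

Lemma bigminn_le_idx (I : Type) (s : seq I) (F : I -> nat) r :
  (\big[minn/r]_(j <- s) F j <= r)%N.
Proof. by elim/big_rec: _ => // i x _; apply: leq_trans; apply: geq_minr. Qed.

Section SDepth.
Variables (K : fieldType) (G : sgraph).
Local Notation mon := 'X_{1..#|G|}.
Local Notation I := (@edge_ideal K G).

Definition sdepth_value d := exists k (a : 'I_k -> edge_ring K G)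
    (X : 'I_k -> {set 'I_#|G|}),
  stanley_decomposition (@quot_comp K #|G| I) a X /\ d = \big[minn/#|G|]_(i < k) #|X i|.

Lemma partition_ord (J : finType) (u : J -> mon) (X : J -> {set 'I_#|G|}) :
  stanley_partition u X ->
  stanley_partition (fun i : 'I_#|J| => u (enum_val i)) (fun i => X (enum_val i)).
Proof.
move=> [std uniq]; split=> [j w|w /uniq[j cj jP]]; first exact: std.
exists (enum_rank j); first by rewrite enum_rankK.
by move=> i /jP <-; rewrite enum_valK.
Qed.

(** The standard monomials, grouped by their supports. *)
Lemma face_partition : exists (J : finType) (u : J -> mon) (X : J -> {set 'I_#|G|}),
  stanley_partition u X.
Proof.
pose J : finType := {A : {set G} | face A}.
pose u (A : J) : mon := [multinom ((enum_val i \in sval A) : nat) | i < #|G|].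
pose X (A : J) := [set i : 'I_#|G| | enum_val i \in sval A].
have cellE (A : J) w : in_cell (u A) (X A) w = (msupport w == sval A).
  apply/andP/eqP => [[/mnm_lepP uw /forall_inP wX]|wA].
    apply/setP => v; rewrite inE; apply/idP/idP => [wv|vA].
      apply: contraR wv => vA; have := wX (enum_rank v).
      by rewrite inE enum_rankK => /(_ vA)/eqP ->; rewrite mnmE enum_rankK (negPf vA).
    by have := uw (enum_rank v); rewrite mnmE enum_rankK vA -lt0n.
  split; first by apply/mnm_lepP => i; rewrite mnmE -wA inE enum_valK; case: (w i).
  apply/forall_inP => i; rewrite inE -wA inE enum_valK negbK => /eqP wi.
  by rewrite wi mnmE -wA inE enum_valK wi.
exists J, u, X; split=> [A w|w sw].
  by rewrite cellE => /eqP wA; rewrite /standard wA; apply: valP.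
exists (exist (fun A => face A) (msupport w) sw); first by rewrite cellE.
by move=> A; rewrite cellE => /eqP e; apply: val_inj.
Qed.

Lemma edge_sdepth_is_max : is_max sdepth_value (edge_sdepth K G).
Proof.
have [J [u [X uX]]] := face_partition.
have [||d maxd] := @bounded_is_max sdepth_value #|G| (\big[minn/#|G|]_(i < #|J|) #|X (enum_val i)|).
- exists #|J|, (fun j => \pi_{ideal_quot I} 'X_[u (enum_val j)]), (fun j => X (enum_val j)).
  by split=> //; apply/partition_decomposition/partition_ord.
- by move=> d [k [a [Y [_ ->]]]]; apply: bigminn_le_idx.
suff -> : edge_sdepth K G = d by [].
exact: is_max_maxP.
Qed.

Lemma partition_edge_sdepth b (J : finType) (u : J -> mon) (X : J -> {set 'I_#|G|}) :
  stanley_partition u X -> (forall j, b <= #|X j|)%N -> (b <= edge_sdepth K G)%N.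
Proof.
move=> uX bX; have [_ maxs] := edge_sdepth_is_max.
have [_ /(_ 0%MM)] := uX; rewrite /standard (_ : msupport _ = set0) => [|]; last first.
  by apply/setP => v; rewrite !inE mnm0E.
move=> /(_ (face0 G))[j0 _ _].
apply: leq_trans (maxs (\big[minn/#|G|]_(i < #|J|) #|X (enum_val i)|) _).
  apply: bigminn_geP => //; apply: leq_trans (bX j0) _.
  by rewrite -[X in (_ <= X)%N]card_ord max_card.
exists #|J|, (fun j => \pi_{ideal_quot I} 'X_[u (enum_val j)]), (fun j => X (enum_val j)).
by split=> //; apply/partition_decomposition/partition_ord.
Qed.

Lemma edge_sdepth_partition : exists k (u : 'I_k -> mon) (X : 'I_k -> {set 'I_#|G|}),
  stanley_partition u X /\ forall i, (edge_sdepth K G <= #|X i|)%N.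
Proof.
have [[k [a [X [dec sE]]]] _] := edge_sdepth_is_max.
have [u uX] := decomposition_partition dec; exists k, u, X; split=> // i.
by rewrite sE; apply: bigminn_le; rewrite mem_index_enum.
Qed.

(** The cell of a monomial with support [A] and large exponents has at least
    the free variables [A], hence exactly these if [A] is a maximal face. *)
Lemma edge_sdepth_le_facet (A : {set G}) : face A ->
  (forall C : {set G}, face C -> A \subset C -> C = A) -> (edge_sdepth K G <= #|A|)%N.
Proof.
move=> fA maxA; have [k [u [X [[std uniq] sX]]]] := edge_sdepth_partition.
(* An exponent larger than all those of the generators of the cells. *)
pose N := (\max_(i < k) mdeg (u i)).+1.
pose w : mon := [multinom (if enum_val i \in A then N else 0)%N | i < #|G|].
have sw : msupport w = A.
  by apply/setP => v; rewrite inE mnmE enum_rankK; case: ifP.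
have [|i ci _] := uniq w; first by rewrite /standard sw.
apply: leq_trans (sX i) _; rewrite -(card_imset A (@enum_rank_inj G)).
apply: subset_leq_card; apply/subsetP => j jX.
have -> : j = enum_rank (enum_val j) by rewrite enum_valK.
apply: imset_f.
have AX v : v \in A -> enum_rank v \in X i.
  move=> vA; apply: contraT => vX; have /andP[_ /forall_inP/(_ _ vX)] := ci.
  rewrite mnmE enum_rankK vA => /eqP NE.
  have : (u i (enum_rank v) < N)%N.
    rewrite ltnS; apply: leq_trans (leq_bigmax i).
    by rewrite mdegE (bigD1 (enum_rank v)) //= leq_addr.
  by rewrite -NE ltnn.
pose w' := (u i + [multinom ((l \in X i) : nat) | l < #|G|])%MM.
have /std sw' : in_cell (u i) (X i) w'.
  by apply/in_cellP; eexists; last reflexivity; move=> l /negPf lX; rewrite mnmE lX.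
rewrite -(maxA _ sw'); first by rewrite inE enum_valK mnmDE mnmE jX addn1.
by apply/subsetP => v /AX vX; rewrite inE mnmDE mnmE vX addn1.
Qed.

End SDepth.

(** * Stanley depth of the corona of a star *)

(** A monomial of [G] whose support lies in a box is determined by its exponents
    on the image of [S], on which the support is arbitrary in the family of the
    box, and by those on [hi], where it must be divisible by [lo]. *)
Section BoxCells.
Variables (G H : sgraph) (iota : H -> G).
Hypothesis iota_inj : injective iota.
Variables (S : {set H}) (lo hi : {set G}).
Hypothesis lo_hi : lo \subset hi.
Hypothesis hi_core : [disjoint hi & iota @: S].
Variables (u : 'X_{1..#|H|}) (X : {set 'I_#|H|}).
Hypothesis uS : forall h, h \notin S -> u (enum_rank h) = 0%N.
Hypothesis XS : forall h, h \notin S -> enum_rank h \notin X.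

Definition restrict_mon (w : 'X_{1..#|G|}) : 'X_{1..#|H|} :=
  [multinom (if enum_val i \in S then w (enum_rank (iota (enum_val i))) else 0)%N
    | i < #|H|].

Definition extend_mon : 'X_{1..#|G|} :=
  [multinom ((enum_val i \in lo) +
     (if [pick h | iota h == enum_val i] is Some h then u (enum_rank h) else 0))%N
    | i < #|G|].

Definition extend_vars : {set 'I_#|G|} :=
  [set enum_rank v | v in hi :|: iota @: [set h | enum_rank h \in X]].

Lemma restrict_monE w h : restrict_mon w (enum_rank h) =
  if h \in S then w (enum_rank (iota h)) else 0%N.
Proof. by rewrite mnmE enum_rankK. Qed.

Lemma msupport_restrict w :
  msupport (restrict_mon w) = trace iota S (msupport w).
Proof.
by apply/setP => h; rewrite !inE restrict_monE; case: (h \in S).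
Qed.

Lemma extend_mon_iota h :
  extend_mon (enum_rank (iota h)) = ((iota h \in lo) + u (enum_rank h))%N.
Proof.
rewrite mnmE enum_rankK; case: pickP => [h' /eqP/iota_inj -> //|/(_ h)].
by rewrite eqxx.
Qed.

Lemma extend_mon_out v : v \notin iota @: S -> extend_mon (enum_rank v) = (v \in lo).
Proof.
move=> vS; rewrite mnmE enum_rankK; case: pickP => [h /eqP hv|]; last by rewrite addn0.
rewrite uS ?addn0 //; apply: contra vS => hS; by rewrite -hv imset_f.
Qed.

Lemma mem_extend_vars v : (enum_rank v \in extend_vars) =
  (v \in hi) || (v \in iota @: [set h | enum_rank h \in X]).
Proof. by rewrite mem_imset ?inE //; apply: enum_rank_inj. Qed.

Lemma core_notin_lo h : h \in S -> iota h \notin lo.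
Proof.
move=> hS; apply: contraL (imset_f iota hS) => /(subsetP lo_hi) hhi.
by rewrite (disjointFr hi_core).
Qed.

(** The cell generated by [lo] and a cell of [H] consists of the monomials with
    support in the box whose restriction to [H] lies in the given cell. *)
Lemma in_cell_box w : in_cell extend_mon extend_vars w =
  [&& lo \subset msupport w, msupport w \subset hi :|: iota @: S
    & in_cell u X (restrict_mon w)].
Proof.
have core_vars h : h \in S -> (enum_rank (iota h) \in extend_vars) = (enum_rank h \in X).
  move=> hS; rewrite mem_extend_vars (mem_imset _ _ iota_inj) inE.
  by rewrite (disjointFl hi_core) // imset_f.
have out_vars v : v \notin iota @: S -> (enum_rank v \in extend_vars) = (v \in hi).
  move=> vS; rewrite mem_extend_vars orbC.
  case: imsetP => //= -[h]; rewrite inE => hX vE; case/negP: vS; rewrite vE imset_f //.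
  by apply: contraLR hX; apply: XS.
apply/andP/and3P => [[/mnm_lepP uw /forall_inP wX]|[/subsetP low /subsetP whi]].
  split.
  - apply/subsetP => v vlo; rewrite inE -lt0n; apply: leq_trans (uw _).
    by rewrite mnmE enum_rankK vlo.
  - apply/subsetP => v; rewrite inE => wv; rewrite in_setU.
    have [//|vS] := boolP (v \in iota @: S); rewrite ?orbT // orbF.
    apply: contraR wv => vhi; have := wX (enum_rank v).
    rewrite out_vars // => /(_ vhi)/eqP ->; rewrite extend_mon_out //.
    by rewrite eqb0; apply: contra vhi; apply: (subsetP lo_hi).
  apply/andP; split.
    apply/mnm_lepP => i; rewrite -[i]enum_valK restrict_monE.
    case: ifPn => [hS|/uS -> //]; apply: leq_trans (uw _).
    by rewrite extend_mon_iota leq_addl.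
  apply/forall_inP => i; rewrite -[i]enum_valK restrict_monE.
  case: ifPn => [hS iX|/uS -> //].
  have := wX (enum_rank (iota (enum_val i))); rewrite core_vars // => /(_ iX)/eqP ->.
  by rewrite extend_mon_iota (negPf (core_notin_lo hS)).
move=> /andP[/mnm_lepP uw /forall_inP wX]; split.
  apply/mnm_lepP => i; rewrite -[i]enum_valK; set v := enum_val i.
  have [/imsetP[h hS ->]|vS] := boolP (v \in iota @: S).
    have := uw (enum_rank h); rewrite restrict_monE hS extend_mon_iota.
    by rewrite (negPf (core_notin_lo hS)).
  rewrite extend_mon_out //; case: (boolP (v \in lo)) => // /low.
  by rewrite inE -lt0n.
apply/forall_inP => i; rewrite -[i]enum_valK; set v := enum_val i.
have [/imsetP[h hS ->]|vS] := boolP (v \in iota @: S).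
  rewrite core_vars // => /wX; rewrite restrict_monE hS extend_mon_iota.
  by rewrite (negPf (core_notin_lo hS)).
rewrite out_vars // => vhi; rewrite extend_mon_out //.
have /negPf -> : v \notin lo by apply: contra vhi; apply: (subsetP lo_hi).
apply: contraR vhi => wv; have := whi v; rewrite inE wv => /(_ isT).
by rewrite in_setU (negPf vS) orbF.
Qed.

Lemma card_extend_vars : #|extend_vars| = (#|hi| + #|X|)%N.
Proof.
rewrite card_imset; last exact: enum_rank_inj.
rewrite cardsU (card_imset _ iota_inj) (_ : _ :&: _ = set0).
  rewrite cards0 subn0; congr (_ + _)%N.
  rewrite -(card_imset _ enum_rank_inj); congr #|pred_of_set _|; apply/setP => i.
  by rewrite -[i]enum_valK (mem_imset _ _ enum_rank_inj) inE.
apply/eqP; rewrite setI_eq0; apply: disjointWr hi_core; apply: imsetS.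
by apply/subsetP => h; rewrite inE; apply: contraLR; apply: XS.
Qed.

End BoxCells.

Section CoronaSdepth.
Variables (K : fieldType) (n : nat) (H : sgraph).
Hypothesis n_gt0 : (0 < n)%N.
Local Notation G := (corona (star n) H).
Local Notation noniso := (~: isolated H).

(** All monomials of a cell are standard, so the variables of the isolated
    vertices do not occur in it. *)
Lemma partition_nonisolated (J : finType) (u : J -> 'X_{1..#|H|})
    (X : J -> {set 'I_#|H|}) j h : stanley_partition u X ->
  h \notin noniso -> u j (enum_rank h) = 0%N /\ enum_rank h \notin X j.
Proof.
move=> [std _]; have std_iso w : in_cell (u j) (X j) w -> h \notin noniso ->
    w (enum_rank h) = 0%N.
  move=> /std/face_nonisolated/subsetP/(_ h); rewrite [_ \in msupport _]inE => sub hn.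
  by apply/eqP; apply: contraNT hn.
move=> hn; split.
  by apply: (std_iso _ _ hn); apply/in_cellP; exists 0%MM; [move=> i _; rewrite mnm0E|rewrite addm0].
apply/negP => hX.
have : in_cell (u j) (X j) (u j + U_(enum_rank h))%MM.
  apply/in_cellP; exists U_(enum_rank h)%MM => // i iX; rewrite mnm1E.
  by case: eqP => // e; rewrite -e hX in iX.
by move=> /std_iso/(_ hn); rewrite mnmDE mnm1E eqxx addn1.
Qed.

(** The cells are indexed by a piece and a cell of an optimal partition for
    [H]. *)
Lemma corona_sdepth :
  (n + edge_sdepth K H + #|isolated H| <= edge_sdepth K G)%N.
Proof.
have [k [u [X [uX sX]]]] := edge_sdepth_partition K H.
have [std uniq] := uX.
pose realized (p : {set 'I_n.+1} * {set 'I_n.+1 * H}) :=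
  [exists A : {set G}, [&& face A, star_part A == p.1 & rest A == p.2]].
pose P : finType := {p | realized p}.
pose J : finType := (P * 'I_k)%type.
pose lo (p : P) := piece_lo (sval p).1 (sval p).2.
pose hi (p : P) := piece_hi (sval p).1 (sval p).2.
pose cp (p : P) : H -> G := copy (kept (sval p).1).
pose uG (j : J) := extend_mon (cp j.1) (lo j.1) (u j.2).
pose XG (j : J) := extend_vars (cp j.1) (hi j.1) (X j.2).
have real (p : P) : exists A : {set G},
    [/\ face A, star_part A = (sval p).1 & rest A = (sval p).2].
  by have /existsP[A /and3P[fA /eqP eT /eqP eL]] := valP p; exists A.
have lohi p : lo p \subset hi p.
  by have [A [fA eT eL]] := real p; rewrite /lo /hi -eT -eL; apply: piece_lo_hi.
have hicore p : [disjoint hi p & cp p @: noniso] by apply: piece_hi_core.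
have cellG j w : in_cell (uG j) (XG j) w = [&& lo j.1 \subset msupport w,
    msupport w \subset hi j.1 :|: cp j.1 @: noniso
  & in_cell (u j.2) (X j.2) (restrict_mon (cp j.1) noniso w)].
  apply: in_cell_box => //; first exact: copy_inj.
  - by move=> h /(partition_nonisolated j.2 uX)[].
  - by move=> h /(partition_nonisolated j.2 uX)[].
have pieceE (p : P) w : piece (sval p).1 (sval p).2 (msupport w) =
    [&& standard w, star_part (msupport w) == (sval p).1 & rest (msupport w) == (sval p).2].
  by have [A [fA <- <-]] := real p; rewrite pieceP.
have cell_piece j w : in_cell (uG j) (XG j) w -> piece (sval j.1).1 (sval j.1).2 (msupport w).
  rewrite cellG => /and3P[low whi /std]; rewrite /standard msupport_restrict => fw.
  by apply/and3P; split.
apply: (@partition_edge_sdepth K G _ J uG XG); last first.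
  move=> j; rewrite (card_extend_vars (@copy_inj n H _) (hicore j.1)); last first.
    by move=> h /(partition_nonisolated j.2 uX)[].
  have [A [fA eT eL]] := real j.1.
  have := card_piece_hi fA; rewrite eT eL -/(hi _) => cA.
  by rewrite addnAC; apply: leq_add (sX j.2).
split=> [j w /cell_piece|w sw]; first by rewrite pieceE => /andP[].
have rw : realized (star_part (msupport w), rest (msupport w)).
  by apply/existsP; exists (msupport w); rewrite /= !eqxx !andbT; apply: sw.
pose p : P := exist (fun q => realized q) _ rw.
have pw : piece (sval p).1 (sval p).2 (msupport w) by rewrite pieceE sw !eqxx.
have /and3P[low whi fw] := pw.
have [|i ci iP] := uniq (restrict_mon (cp p) noniso w).
  by rewrite /standard msupport_restrict.
exists (p, i); first by rewrite cellG; apply/and3P.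
move=> [q i'] cq; have := cell_piece _ _ cq; rewrite pieceE => /and3P[_ /eqP e1 /eqP e2].
have qp : q = p by apply: val_inj; rewrite /= e1 e2 -surjective_pairing.
by move: cq; rewrite qp cellG => /and3P[_ _ /iP /= ->].
Qed.

(** If [H] is null, no vertex of the kept copy is left outside [hi], and
    [leaf_face] is a maximal face. *)
Lemma null_corona_sdepth : null_graph H -> edge_sdepth K G = (n + #|H|)%N.
Proof.
move=> nullH; have isoT : isolated H = setT.
  by apply/setP => h; rewrite !inE; apply/forallP => h'; apply: nullH.
apply/anti_leq/andP; split; last first.
  by apply: leq_trans corona_sdepth; rewrite isoT cardsT addnAC leq_addr.
have <- : #|leaf_face n H| = (n + #|H|)%N by rewrite card_leaf_face // isoT cardsT.
apply: edge_sdepth_le_facet; first exact: face_leaf_face.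
move=> C fC FC; have := face_leaf n_gt0 C; rewrite FC fC => /esym/and3P[_ CF _].
apply/eqP; rewrite eqEsubset FC andbT.
by move: CF; rewrite isoT setCT imset0 setU0.
Qed.
End CoronaSdepth.

Local Close Scope quotient_scope.
Local Close Scope ring_scope.

Theorem theorem2p17 (K : fieldType) (n : nat) (H : sgraph) (n_ge1 : 1 <= n) :
  [/\ edge_depth K (corona (star n) H) = n + edge_depth K H + #|isolated H|,
      n + edge_sdepth K H + #|isolated H| <= edge_sdepth K (corona (star n) H)
    & null_graph H -> edge_sdepth K (corona (star n) H) = n + #|H| ].
Proof.
split; [exact: corona_depth|exact: corona_sdepth|exact: null_corona_sdepth].
Qed.
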